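(* There is an absolute constant $C>0$ such that the following holds for every finite field $\mathbb{F}_q$, every degree $d$, every $m\ge 2$ and every $\epsilon_0\in(0,1)$ with $\epsilon_0\ge C\,(d/q)^{1/48}$. For every $\epsilon\ge\epsilon_0$, if a points table $f:\mathbb{F}_q^m\to\mathbb{F}_q$ and a degree-$d$ lines oracle $\ell\mapsto P_\ell$ satisfy $$\Pr_{\mathbf{x}\in\mathbb{F}_q^m,\ \ell\ni\mathbf{x}}[f(\mathbf{x})=P_\ell(\mathbf{x})]\ge 5\epsilon,$$ then there exists an $m$-variate polynomial $Q$ of total degree at most $d$ with $\Pr_{\mathbf{x}}[f(\mathbf{x})=Q(\mathbf{x})]\ge\epsilon^2$.
   Context: An (affine) line in $\mathbb{F}_q^m$ is a set $\ell=\{\mathbf{a}+t\mathbf{u}:t\in\mathbb{F}_q\}$ with $\mathbf{u}\neq 0$; a degree-$d$ polynomial on $\ell$ is a function on $\ell$ given, under a parametrization, by a univariate polynomial of degree at most $d$ in $t$. A degree-$d$ lines oracle assigns to every line $\ell$ a degree-$d$ polynomial $P_\ell$ on $\ell$. In probabilities, $\mathbf{x}$ is uniform and $\ell\ni\mathbf{x}$ is a uniformly random line through $\mathbf{x}$. *)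

(* Defs.v *)
From HB Require Import structures.
From mathcomp Require Import all_boot all_order all_algebra.
From mathcomp Require Import mpoly.
Set Implicit Arguments. Unset Strict Implicit. Unset Printing Implicit Defensive.
Import Order.TTheory GRing.Theory Num.Theory.
Local Open Scope ring_scope.

Section LinesDefs.
Variables (F : finFieldType) (m : nat).
Local Notation pt := 'rV[F]_m.

Definition line (a u : pt) : {set pt} := [set a + t *: u | t : F].

Definition is_line (L : {set pt}) : bool :=
  [exists a : pt, exists u : pt, (u != 0) && (L == line a u)].

Definition lines : {set {set pt}} := [set L | is_line L].

Definition lines_through (x : pt) : {set {set pt}} :=
  [set L in lines | x \in L].

(* A degree-d lines oracle: to every line L a function P L on L which,
   under a parametrization t |-> a + t u of L, is a univariate polynomial
   of degree at most d in t.  (Values of P L outside L are irrelevant.) *)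
Definition is_lines_oracle (d : nat) (P : {set pt} -> pt -> F) : Prop :=
  forall L, is_line L ->
    exists a u : pt, exists p : {poly F},
      [/\ u != 0, L = line a u, (size p <= d.+1)%N &
          forall t : F, P L (a + t *: u) = p.[t]].

Definition agreement (R : numFieldType) (f : pt -> F) (P : {set pt} -> pt -> F)
  : R :=
  (#|[set: pt]|%:R)^-1 *
  \sum_(x : pt) (#|lines_through x|%:R)^-1 *
     \sum_(L in lines_through x) (f x == P L x)%:R.

Definition mpeval (Q : {mpoly F[m]}) (x : pt) : F := Q.@[fun i => x ord0 i].

Definition tdeg_le (d : nat) (Q : {mpoly F[m]}) : bool := (msize Q <= d.+1)%N.

Definition pt_agreement (R : numFieldType) (f : pt -> F) (Q : {mpoly F[m]}) : R :=
  #|[set x : pt | f x == mpeval Q x]|%:R / #|[set: pt]|%:R.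

End LinesDefs.

(* Main.v *)
(** Lines are parametrised as [t |-> x + t u] with (x, u) uniform in V * V.

    In a plane, prune the point-line incidences on which f and the oracle agree
    to a core of large minimum degree, and take a nonzero A(X, Y, Z) of least
    degree vanishing on the graph of f over the core, with restrictions to lines
    of degree below the line degrees of the core. Then A vanishes on the graph
    of the oracle's polynomial on every core line. Minimality, the chain rule
    along core lines and p-th roots in characteristic p provide a core point at
    which f is a simple root of A in Z; Hensel lifting there produces one
    bivariate polynomial of degree at most d that restricts to the oracle's
    polynomial on all core lines through that point.

    In dimension m, list decoding in planes shows that for a typical base point
    the oracle's polynomials along the lines through it that agree with f there
    form a partial function that, on most planes, nearly coincides with a
    bivariate polynomial. Taking best fits on lines turns it into a total
    function passing the line test with probability close to 1. Correcting the
    latter along planes through an arbitrary point, then along planes through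
    an arbitrary line, gives a function of degree at most d on every line,
    hence a polynomial of total degree at most d. *)

(* The obstacle is that an agreement of order eps pins down no single polynomial: on a plane, f may
   be close to about eps^-2 of them. A base point x breaks the tie, because two distinct low-degree
   polynomials rarely agree at a random x, so that the value f(x) typically selects at most one
   member of the list. The price is to work with pairs of agreeing points on a line, whose density
   is about (5 eps)^2 by Cauchy-Schwarz; this is the source of eps^2 in the conclusion: 25 eps^2 -
   1/q is at least 24 eps^2, of which 3 eps^2 pays for the choice of the base point, and a twentieth
   of the remaining 21 eps^2 survives the later steps. The large exponent comes from accuracy: the
   inconsistency e / eps^2 left at the base point must be a small multiple of the squared density,
   of order eps^4, so the plane lists are used at a threshold e of order eps^6, and they ask d/q to
   be below about e^5. *)
Require Import Defs.
From HB Require Import structures.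
From mathcomp Require Import all_boot all_order all_algebra.
From mathcomp Require Import ring lra zify.
From mathcomp Require mpoly.
From mathcomp Require Import boolp finfield.
Set Implicit Arguments. Unset Strict Implicit. Unset Printing Implicit Defensive.
Import Order.TTheory GRing.Theory Num.Theory.
Local Open Scope ring_scope.

(** * Substitution of univariate polynomials, Taylor expansion along lines, Hensel lifting *)

Module Algebra.
Import mpoly.

Section MpolyInduction.
Variables (K : comNzRingType) (n : nat).

Lemma mpoly_ring_ind (Pr : {mpoly K[n]} -> Prop) :
  (forall c, Pr c%:MP) -> (forall i, Pr 'X_i) ->
  (forall p q, Pr p -> Pr q -> Pr (p + q)) ->
  (forall p q, Pr p -> Pr q -> Pr (p * q)) -> forall p, Pr p.
Proof.
move=> hC hX hD hM; elim/mpolyind => [|c m p _ _ hp]; first exact: hC.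
apply: hD => //; rewrite -mul_mpolyC; apply: (hM); first exact: hC.
rewrite mpolyXE_id; apply: (big_ind Pr) => [|x y hx hy|i _]; first exact: hC.
  exact: hM.
by elim: (m i) => [|k IH]; [rewrite expr0; exact: hC | rewrite exprS; exact: hM].
Qed.

End MpolyInduction.

Notation subst_poly h A := (mmap (@polyC _) h A).

Section Substitution.
Variables (F : fieldType) (n : nat).
Implicit Types (A : {mpoly F[n]}) (h : 'I_n -> {poly F}).

Lemma horner_subst_poly h A t :
  (subst_poly h A).[t] = A.@[fun i => (h i).[t]].
Proof.
elim/mpoly_ring_ind: A => [c|i|p q hp hq|p q hp hq].
- by rewrite mmapC mevalC hornerC.
- by rewrite mmapX mmap1U mevalXU.
- by rewrite !rmorphD hornerD hp hq.
- by rewrite !rmorphM hornerM hp hq.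
Qed.

(** The weights are there because Z will become a polynomial of degree d while the coordinates
    become linear in t. *)
Lemma size_subst_poly h A (w : 'I_n -> nat) (D : nat) :
  (forall i, (size (h i) <= (w i).+1)%N) ->
  {in msupp A, forall m : 'X_{1..n}, (\sum_i m i * w i <= D)%N} ->
  (size (subst_poly h A) <= D.+1)%N.
Proof.
move=> hw hD; rewrite /mmap big_seq; apply: (leq_trans (size_sum _ _ _)).
apply/bigmax_leqP_seq => m mA _.
rewrite mul_polyC; apply: (leq_trans (size_scale_leq _ _)).
apply: (leq_trans _ (hD m mA : _.+1 <= D.+1)%N).
rewrite /mmap1.
apply: (big_ind2 (fun (p : {poly F}) a => (size p <= a.+1)%N))
  => [|p a r b ha hb|i _].
- by rewrite size_poly1.
- apply: (leq_trans (size_polyMleq _ _)); move: ha hb.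
  by case: (size p) (size r) => [|x] [|y] /=; lia.
- apply: (leq_trans (size_poly_exp_leq _ _)); rewrite ltnS mulnC leq_mul2l.
  by case: (size (h i)) (hw i) => [|x] /=; rewrite ?orbT // ltnS => ->; rewrite orbT.
Qed.

Lemma deriv_subst_poly h A :
  (subst_poly h A)^`() = \sum_i subst_poly h A^`M(i) * (h i)^`().
Proof.
elim/mpoly_ring_ind: A => [c|i|p q hp hq|p q hp hq].
- rewrite mmapC derivC big1 // => i _.
  by rewrite mderivC mmap0 mul0r.
- rewrite mmapX mmap1U (bigD1 i) //= big1 ?addr0 => [|j ji].
    rewrite mderivX mnm1E eqxx scale1r.
    have -> : (U_(i) - U_(i) = 0)%MM by apply/mnmP => k; rewrite mnmBE mnm0E subnn.
    by rewrite mpolyX0 rmorph1 mul1r.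
  by rewrite mderivX mnm1E eq_sym (negbTE ji) scale0r mmap0 mul0r.
- rewrite rmorphD derivD hp hq -big_split /=; apply: eq_bigr => i _.
  by rewrite mderivD rmorphD mulrDl.
- rewrite rmorphM derivM hp hq mulr_suml mulr_sumr -big_split /=.
  apply: eq_bigr => i _; rewrite mderivM rmorphD !rmorphM /=; ring.
Qed.

(** First-order expansion in one slot with a remainder divisible by e^2, as a Newton step
    requires. *)
Lemma subst_poly_taylor h h' A (j : 'I_n) (e : {poly F}) :
  h' j = h j + e -> (forall i, i != j -> h' i = h i) ->
  exists c, subst_poly h' A =
    subst_poly h A + e * subst_poly h A^`M(j) + e ^+ 2 * c.
Proof.
move=> hj hi; elim/mpoly_ring_ind: A => [c|i|p q [c hp] [c' hq]|p q [c hp] [c' hq]].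
- by exists 0; rewrite !mmapC mderivC mmap0 !mulr0 !addr0.
- exists 0; rewrite !mmapX !mmap1U mderivX mnm1E mulr0 addr0.
  have [->|ij] := eqVneq i j.
    have -> : (U_(j) - U_(j) = 0)%MM by apply/mnmP => k; rewrite mnmBE mnm0E subnn.
    by rewrite scale1r mpolyX0 rmorph1 mulr1.
  by rewrite hi // scale0r mmap0 mulr0 addr0.
- by exists (c + c'); rewrite mderivD !rmorphD /= hp hq; ring.
- exists (subst_poly h p * c' + c * subst_poly h q
     + subst_poly h p^`M(j) * subst_poly h q^`M(j)
     + e * (subst_poly h p^`M(j) * c' + c * subst_poly h q^`M(j))
     + e ^+ 2 * (c * c')).
  by rewrite mderivM !rmorphD !rmorphM /= hp hq; ring.
Qed.

Lemma subst_poly_comp m h (g : 'I_m -> {mpoly F[n]}) (A : {mpoly F[m]}) :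
  subst_poly h (mmap (@mpolyC n F) g A) = subst_poly (fun i => subst_poly h (g i)) A.
Proof.
elim/mpoly_ring_ind: A => [c|i|p q hp hq|p q hp hq].
- by rewrite !mmapC.
- by rewrite !mmapX !mmap1U.
- by rewrite !rmorphD /= hp hq.
- by rewrite !rmorphM /= hp hq.
Qed.

Lemma eq_subst_poly h h' A : h =1 h' -> subst_poly h A = subst_poly h' A.
Proof.
move=> e; rewrite /mmap; apply: eq_bigr => m _; congr (_ * _).
exact: mmap1_eq.
Qed.

End Substitution.

Lemma msize_mul_le (F : fieldType) n (p q : {mpoly F[n]}) a b :
  (msize p <= a.+1)%N -> (msize q <= b.+1)%N -> (msize (p * q) <= (a + b).+1)%N.
Proof.
have [->|p0] := eqVneq p 0; first by rewrite mul0r msize0.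
have [->|q0] := eqVneq q 0; first by rewrite mulr0 msize0.
by rewrite msizeM //; set x := msize p; set y := msize q; lia.
Qed.

Section Lines.
Variables (F : fieldType) (n : nat).
Implicit Types (x u : 'rV[F]_n).

Definition lpar x u (i : 'I_n) : {poly F} := (x 0 i)%:P + u 0 i *: 'X.

Lemma size_lpar x u i : (size (lpar x u i) <= 2)%N.
Proof.
apply: (leq_trans (size_polyD _ _)); rewrite geq_max size_polyC.
rewrite (leq_trans (leq_b1 _)) //=.
by apply: (leq_trans (size_scale_leq _ _)); rewrite size_polyX.
Qed.

Lemma horner_lpar x u i t : (lpar x u i).[t] = (x + t *: u) 0 i.
Proof. by rewrite /lpar !hornerE !mxE mulrC. Qed.

Lemma horner_lpar_subst x u (B : {mpoly F[n]}) t :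
  (subst_poly (lpar x u) B).[t] = B.@[fun i => (x + t *: u) 0 i].
Proof. by rewrite horner_subst_poly; apply: meval_eq => i; rewrite horner_lpar. Qed.

Lemma size_lpar_subst x u (B : {mpoly F[n]}) (d : nat) :
  (msize B <= d.+1)%N -> (size (subst_poly (lpar x u) B) <= d.+1)%N.
Proof.
move=> hB; apply: (@size_subst_poly _ _ _ _ (fun=> 1%N)).
  by move=> i; exact: size_lpar.
move=> m mB; have := leq_trans (msize_mdeg_lt mB) hB; rewrite ltnS mdegE.
by under [in X in _ -> X]eq_bigr do rewrite muln1.
Qed.

(* [G k] is the degree-k part of the Taylor expansion of B at x. *)
Lemma taylor_parts x (B : {mpoly F[n]}) :
  exists G : nat -> {mpoly F[n]}, forall k, (msize (G k) <= k.+1)%N /\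
    forall u, subst_poly (lpar x u) (G k) =
      (subst_poly (lpar x u) B)`_k *: 'X^k.
Proof.
elim/mpoly_ring_ind: B => [c|i|p q [G hG] [G' hG']|p q [G hG] [G' hG']].
- exists (fun k => if k is 0 then c%:MP else 0) => -[|k]; split.
  + by rewrite mmeasureC leq_b1.
  + by move=> u; rewrite !mmapC coefC /= expr0 alg_polyC.
  + by rewrite msize0.
  + by move=> u; rewrite mmap0 mmapC coefC scale0r.
- exists (fun k => match k with 0 => (x 0 i)%:MP
            | 1 => 'X_i - (x 0 i)%:MP | _ => 0 end) => -[|[|k]]; split.
  + by rewrite mmeasureC leq_b1.
  + move=> u; rewrite mmapC mmapX mmap1U /lpar coefD coefC coefZ coefX /=.
    by rewrite mulr0 addr0 expr0 alg_polyC.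
  + apply: (leq_trans (mmeasureD_le _ _ _)); rewrite geq_max mmeasureN mmeasureC.
    by rewrite msizeX mdeg1 (leq_trans (leq_b1 _)).
  + move=> u; rewrite rmorphB /= mmapC mmapX mmap1U /lpar coefD coefC coefZ coefX /=.
    by rewrite add0r mulr1 expr1 addrC addKr.
  + by rewrite msize0.
  + move=> u; rewrite mmap0 mmapX mmap1U /lpar coefD coefC coefZ coefX /=.
    by rewrite mulr0 addr0 scale0r.
- exists (fun k => G k + G' k) => k; have [s1 e1] := hG k; have [s2 e2] := hG' k.
  split=> [|u]; last by rewrite !rmorphD /= e1 e2 coefD scalerDl.
  by apply: (leq_trans (mmeasureD_le _ _ _)); rewrite geq_max s1 s2.
- exists (fun k => \sum_(j < k.+1) G j * G' (k - j)%N) => k; split=> [|u].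
    apply: (leq_trans (mmeasure_sum _ _ _ _)); apply/bigmax_leqP => j _.
    apply: leq_trans (msize_mul_le (hG j).1 (hG' (k - j)%N).1) _.
    by rewrite subnKC // -ltnS.
  rewrite rmorph_sum rmorphM /= coefM scaler_suml; apply: eq_bigr => j _.
  rewrite rmorphM /= (hG j).2 (hG' (k - j)%N).2 -scalerAl -scalerAr scalerA -exprD.
  by rewrite subnKC // -ltnS.
Qed.

End Lines.

Section Graph.
Variables (F : fieldType) (n : nat).
Implicit Types (x u : 'rV[F]_n) (A : {mpoly F[n.+1]}).

(* Variable [ord0] of A plays the role of Z, the others are coordinates. *)
Definition gpar x u (p : {poly F}) (i : 'I_n.+1) : {poly F} :=
  if unlift ord0 i is Some j then lpar x u j else p.

Definition gpt x (z : F) (i : 'I_n.+1) : F :=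
  if unlift ord0 i is Some j then x 0 j else z.

Lemma horner_gpar x u p A t :
  (subst_poly (gpar x u p) A).[t] = A.@[gpt (x + t *: u) p.[t]].
Proof.
rewrite horner_subst_poly; apply: meval_eq => i; rewrite /gpar /gpt.
by case: unlift => // j; rewrite horner_lpar.
Qed.

(* Hensel lifting: over a simple root z of A(x, Z), the branch through
   (x, z) is determined, degree by degree, by polynomials in the direction. *)
Lemma hensel_lines x z A (c := A^`M(ord0).@[gpt x z]) (N : nat) : c != 0 ->
  exists2 Q : {mpoly F[n]}, (msize Q <= N.+1)%N &
    forall u p, p.[0] = z -> subst_poly (gpar x u p) A = 0 ->
    forall i, (i <= N)%N -> p`_i = (subst_poly (lpar x u) Q)`_i.
Proof.
move=> c0; elim: N => [|N [Q sQ hQ]].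
  exists z%:MP; first by rewrite mmeasureC leq_b1.
  move=> u p pz _ [|i] // _; rewrite mmapC coefC eqxx.
  by rewrite -horner_coef0.
(* Substituting Q for Z gives one polynomial in the coordinates whose part of degree N+1 at x
   measures the error in all directions at once. *)
pose g (i : 'I_n.+1) := if unlift ord0 i is Some j then 'X_j else Q.
have [G hG] := taylor_parts x (mmap (@mpolyC n F) g A).
have [sG eG] := hG N.+1.
(* Newton correction: in degree N+1, A(line, p) = 0 reads A(line, Q) + c (p - Q) = 0, since p - Q
   starts in degree N+1 and its square only in degree 2N+2. *)
exists (Q - c^-1 *: G N.+1).
  apply: (leq_trans (mmeasureD_le _ _ _)); rewrite geq_max mmeasureN.
  by rewrite (leq_trans sQ) // (leq_trans (msizeZ_le _ _)).
move=> u p pz Ap i iN; rewrite rmorphB /= mmapZ eG.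
set r := subst_poly (lpar x u) Q.
have EB : subst_poly (lpar x u) (mmap (@mpolyC n F) g A) =
          subst_poly (gpar x u r) A.
  rewrite subst_poly_comp; apply: eq_subst_poly => j; rewrite /g /gpar.
  by case: unlift => // k; rewrite mmapX mmap1U.
rewrite EB coefB mul_polyC !coefZ coefXn.
have [iN'|] := ltnP i N.+1.
  rewrite (ltn_eqF iN') !mulr0 subr0; exact: hQ pz Ap i iN'.
move=> iN'; have {iN'} -> : i = N.+1 by apply/eqP; rewrite eqn_leq iN.
rewrite eqxx mulr1.
pose s := drop_poly N.+1 (p - r).
have es : p - r = s * 'X^(N.+1).
  rewrite -[LHS](poly_take_drop N.+1) -/s (_ : take_poly _ _ = 0) ?add0r //.
  apply/polyP => k; rewrite coef_take_poly coef0; case: ltnP => // kN.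
  by rewrite coefB (hQ u p pz Ap k) ?subrr.
have rz : r.[0] = z by rewrite -pz !horner_coef0 (hQ u p pz Ap 0%N).
have [k ek] := @subst_poly_taylor F n.+1 (gpar x u r) (gpar x u p) A ord0 (p - r)
  (ltac:(by rewrite /gpar unlift_none addrC subrK))
  (ltac:(by move=> j /eqP j0; rewrite /gpar; case: unliftP => // e; case: j0)).
have := congr1 (fun q : {poly F} => q`_N.+1) (etrans (esym Ap) ek).
rewrite /= coef0 !coefD es -mulrA mulrCA coefXnM ltnn subnn.
have -> : (s * 'X^(N.+1)) ^+ 2 * k = 'X^(N.+1 + N.+1) * (s ^+ 2 * k).
  by rewrite exprD; ring.
rewrite coefXnM (_ : (N.+1 < N.+1 + N.+1)%N); last by lia.
rewrite addr0 coef0M -!horner_coef0 horner_gpar scale0r addr0 rz -/c => /eqP.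
rewrite addrC eq_sym addr_eq0 => /eqP es0.
have := congr1 (fun q : {poly F} => q`_N.+1) es.
rewrite /= coefB coefMXn ltnn subnn -horner_coef0 => /eqP.
rewrite subr_eq => /eqP ->; rewrite addrC; congr (_ + _).
by rewrite -[s.[0]](mulfK c0) es0 mulNr mulrC.
Qed.

End Graph.
End Algebra.

(** * Minimal vanishing polynomials over a finite field and interpolation by counting *)

Module Interpolation.
Import mpoly Algebra.

Section MinimalPolynomial.
Variables (F : finFieldType) (k : nat).
Implicit Types (A B : {mpoly F[k]}).

Lemma frobenius_root (p : nat) : p \in [pchar F] ->
  exists g : F -> F, forall c, g c ^+ p = c.
Proof.
move=> hp; have [|g _ hg] := @injF_bij _ (pFrobenius_aut hp).
  exact: fmorph_inj.
by exists g => c; rewrite -(pFrobenius_autE hp) hg.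
Qed.

Lemma dvdn_mderiv_eq0 (p : nat) A (m : 'X_{1..k}) (i : 'I_k) :
  p \in [pchar F] -> A^`M(i) = 0 -> m \in msupp A -> (p %| m i)%N.
Proof.
move=> hp hA mA; case em: (m i) => [|l]; first exact: dvdn0.
have := mcoeff_mderiv i A (m - U_(i))%MM; rewrite hA mcoeff0.
rewrite submK; last by apply/mnm_lepP => j; rewrite mnm1E; case: eqP => [<-|//]; rewrite em.
rewrite mnmBE mnm1E eqxx em subn1 /= -mulr_natr => /esym/eqP.
rewrite mulf_eq0 -[_ == 0]negbK -mcoeff_msupp mA /=.
by rewrite (dvdn_pcharf hp).
Qed.

(** All exponents are multiples of p, and all coefficients have p-th roots since Frobenius is
    bijective on a finite field. The clause on supports keeps B within any weight bound satisfied by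
    A. *)
Lemma pth_root A : A != 0 -> (forall i, A^`M(i) = 0) ->
  exists (p : nat) (B : {mpoly F[k]}), [/\ (1 < p)%N, B != 0,
    {in msupp B, forall m : 'X_{1..k}, (m *+ p)%MM \in msupp A} &
    forall v, A.@[v] = B.@[v] ^+ p].
Proof.
move=> A0 hA; have [p p_pr hp] := finPcharP F.
have [g hg] := frobenius_root hp.
have g0 : g 0 = 0.
  by apply/eqP; have /eqP := hg 0; rewrite expf_eq0 => /andP[].
pose dv (m : 'X_{1..k}) : 'X_{1..k} := [multinom (m i %/ p)%N | i < k].
have dvK (m : 'X_{1..k}) : m \in msupp A -> (dv m *+ p)%MM = m.
  move=> mA; apply/mnmP => i; rewrite mulmnE mnmE divnK //.
  exact: dvdn_mderiv_eq0 hp (hA i) mA.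
pose B := \sum_(m <- msupp A) g A@_m *: 'X_[dv m].
have cB (m : 'X_{1..k}) : B@_m = g A@_(m *+ p)%MM.
  rewrite /B raddf_sum /=.
  have other m' : m' \in msupp A -> m' != (m *+ p)%MM ->
      (g A@_m' *: 'X_[dv m'])@_m = 0.
    move=> m'A ne; rewrite mcoeffZ mcoeffX; case: eqP => [e|_]; last by rewrite mulr0.
    by move: ne; rewrite -e dvK ?eqxx.
  case mA: ((m *+ p)%MM \in msupp A).
    rewrite (bigD1_seq _ mA (msupp_uniq A)) /= big_seq_cond big1 ?addr0.
      rewrite mcoeffZ mcoeffX (_ : dv _ = m) ?eqxx ?mulr1 //.
      by apply/mnmP => i; rewrite mnmE mulmnE mulnK // prime_gt0.
    by move=> m' /andP[? ?]; apply: other.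
  rewrite (memN_msupp_eq0 (negbT mA)) g0 big_seq big1 // => m' m'A.
  by apply: other => //; apply: contraFN mA => /eqP <-.
exists p, B; split.
- exact: prime_gt1.
- apply/eqP => B0; have := mlead_supp A0; set m0 := mlead A => m0A.
  have := cB (dv m0); rewrite B0 mcoeff0 dvK // => /esym e.
  have := hg A@_m0; rewrite e expr0n (gtn_eqF (prime_gt0 p_pr)) => /esym/eqP.
  by apply/negP; rewrite -mcoeff_msupp.
- move=> m; rewrite mcoeff_msupp cB mcoeff_msupp; apply: contraNneq => ->.
  by rewrite g0.
- move=> v; rewrite mevalE /B raddf_sum /= -(pFrobenius_autE hp) rmorph_sum /=.
  rewrite !big_seq; apply: eq_bigr => m mA.
  rewrite pFrobenius_autE mevalZ mevalX exprMn hg; congr (_ * _).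
  rewrite -prodrXl; apply: eq_bigr => i _.
  by rewrite -exprM mnmE divnK // (dvdn_mderiv_eq0 hp (hA i) mA).
Qed.

Lemma msize_mderiv A i : A != 0 -> (msize A^`M(i) < msize A)%N.
Proof.
move=> A0; have sA : (0 < msize A)%N by rewrite lt0n mmeasure_poly_eq0.
rewrite -(prednK sA) ltnS msizeE; apply/bigmax_leqP_seq => m mA _.
have : (m + U_(i))%MM \in msupp A.
  rewrite mcoeff_msupp; move: mA; rewrite mcoeff_msupp mcoeff_mderiv.
  by apply: contraNneq => ->; rewrite mul0rn.
move/msize_mdeg_lt; rewrite mdegD mdeg1; move: sA.
by set a := msize A; set b := mdeg m; lia.
Qed.

(* Take B of least degree: were all its partial derivatives zero, it would be a
   p-th power, and the root would still vanish on T. *)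
Lemma minimal_vanishing (w : 'I_k -> nat) (D : nat) (T : ('I_k -> F) -> Prop) :
  (exists v, T v) ->
  forall A, A != 0 ->
    {in msupp A, forall m : 'X_{1..k}, (\sum_i m i * w i <= D)%N} ->
    (forall v, T v -> A.@[v] = 0) ->
  exists B, [/\ {in msupp B, forall m : 'X_{1..k}, (\sum_i m i * w i <= D)%N},
    forall v, T v -> B.@[v] = 0,
    forall i, (forall v, T v -> (B^`M(i)).@[v] = 0) -> B^`M(i) = 0 &
    exists i, B^`M(i) != 0].
Proof.
move=> [v0 Tv0] A; have [N] := ubnP (msize A).
elim: N A => // N IH A; rewrite ltnS => sA A0 wA TA.
(* A non-zero partial derivative that still vanishes on T is a smaller candidate of no larger
   weight. *)
case: (pselect (exists2 i, A^`M(i) <> 0 & forall v, T v -> (A^`M(i)).@[v] = 0)).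
  move=> [i /eqP Ai0 Ti]; apply: (IH A^`M(i)) => //.
    by apply: leq_trans sA; exact: msize_mderiv.
  move=> m mA; have mA' : (m + U_(i))%MM \in msupp A.
    rewrite mcoeff_msupp; move: mA; rewrite mcoeff_msupp mcoeff_mderiv.
    by apply: contraNneq => ->; rewrite mul0rn.
  apply: leq_trans (wA _ mA'); apply: leq_sum => j _.
  by rewrite mnmDE mulnDl leq_addr.
move=> hA; have hA' i : (forall v, T v -> (A^`M(i)).@[v] = 0) -> A^`M(i) = 0.
  by move=> h; apply: contrapT => ne; apply: hA; exists i.
case: (pselect (exists i, A^`M(i) != 0)) => [?|hz]; first by exists A; split.
have {}hz i : A^`M(i) = 0 by apply: contrapT => /eqP ne; apply: hz; exists i.
have [p [B [p1 B0 sB eB]]] := pth_root A0 hz.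
have TB v : T v -> B.@[v] = 0.
  by move=> Tv; have := TA v Tv; rewrite eB => /eqP; rewrite expf_eq0 => /andP[_ /eqP].
apply: (IH B) => //; last first.
  move=> m mB; apply: leq_trans (wA _ (sB m mB)); apply: leq_sum => j _.
  by rewrite mulmnE leq_mul2r (leq_pmulr (m j) (ltnW p1)) orbT.
apply: leq_trans sA.
(* B is non-zero with a zero at v0, hence not constant; so extracting a p-th root strictly lowers
   the degree. *)
have sBgt : (1 < msize B)%N.
  rewrite ltnNge; apply/negP => /msize1_polyC eBC.
  by move: B0; have := TB v0 Tv0; rewrite eBC mevalC => ->; rewrite mpolyC0 eqxx.
have := msize_mdeg_lt (sB _ (mlead_supp B0)); rewrite mdegMn -(mlead_deg B0).
move: sBgt; rewrite -(mlead_deg B0); set a := mdeg _; set b := msize A; nia.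
Qed.

End MinimalPolynomial.

(** With more monomials than points, the evaluation matrix has a non-zero left kernel vector. *)
Lemma interpolation (F : finFieldType) (k : nat) (T : finType)
    (pt : T -> 'I_k -> F) (s : seq 'X_{1..k}) :
  uniq s -> (#|T| < size s)%N ->
  exists A : {mpoly F[k]}, [/\ A != 0, {subset msupp A <= s} &
    forall x, A.@[pt x] = 0].
Proof.
move=> us sT; set N := size s.
pose mon (i : 'I_N) : 'X_{1..k} := nth 0%MM s i.
pose M : 'M[F]_(N, #|T|) := \matrix_(i, j) \prod_l pt (enum_val j) l ^+ mon i l.
pose c := nz_row (kermx M).
have c0 : c != 0.
  rewrite nz_row_eq0 -mxrank_eq0 mxrank_ker subn_eq0 -ltnNge.
  exact: leq_ltn_trans (rank_leq_col M) sT.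
have cM : c *m M = 0 by apply/sub_kermxP/nz_row_sub.
have mon_inj : injective mon.
  move=> i j /eqP; rewrite /mon nth_uniq // => /eqP; exact: val_inj.
pose A := \sum_i c 0 i *: 'X_[mon i] : {mpoly F[k]}.
have cA i : A@_(mon i) = c 0 i.
  rewrite /A raddf_sum (bigD1 i) //= big1 => [|j ji].
    by rewrite mcoeffZ mcoeffX eqxx mulr1 addr0.
  by rewrite mcoeffZ mcoeffX (inj_eq mon_inj) (negbTE ji) mulr0.
exists A; split.
- apply: contraNneq c0 => A0; apply/eqP/rowP => i.
  by rewrite -cA A0 mcoeff0 mxE.
- move=> m /msupp_sum_le; rewrite filter_predT => /flattenP[t /mapP[i _ ->]].
  by move=> /msuppZ_le /mem_msuppXP <-; rewrite mem_nth.
- move=> x; rewrite /A raddf_sum /=.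
  transitivity ((c *m M) 0 (enum_rank x)); last by rewrite cM mxE.
  rewrite mxE; apply: eq_bigr => i _.
  by rewrite mevalZ mevalX mxE enum_rankK.
Qed.

End Interpolation.

(* Averages over finite types *)
Reserved Notation "\avg_ ( i : t ) F"
  (at level 41, F at level 41, i at level 50, format "\avg_ ( i  :  t )  F").

Definition avg (R : numFieldType) (T : finType) (f : T -> R) : R :=
  (\sum_x f x) / #|T|%:R.

Notation "\avg_ ( i : t ) F" := (avg (fun i : t => F)) : ring_scope.

Section Averages.
Variable R : realFieldType.
Implicit Types (T S : finType).

Lemma eq_avg T (f g : T -> R) : f =1 g -> avg f = avg g.
Proof. by move=> e; rewrite /avg (eq_bigr g). Qed.

Lemma ler_avg T (f g : T -> R) : (forall x, f x <= g x) -> avg f <= avg g.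
Proof. by move=> h; rewrite ler_wpM2r ?invr_ge0 ?ler0n // ler_sum. Qed.

Lemma avg_const T (c : R) (x : T) : \avg_(_ : T) c = c.
Proof.
rewrite /avg sumr_const -[c *+ _]mulr_natr mulfK // pnatr_eq0 -lt0n.
by apply/card_gt0P; exists x.
Qed.

Lemma avg_ge0 T (f : T -> R) : (forall x, 0 <= f x) -> 0 <= avg f.
Proof. by move=> h; rewrite divr_ge0 ?ler0n // sumr_ge0. Qed.

Lemma avg_le T (f : T -> R) c (x : T) : (forall x, f x <= c) -> avg f <= c.
Proof. by move=> h; rewrite -[leRHS](avg_const c x) ler_avg. Qed.

Lemma avg_ge T (f : T -> R) c (x : T) : (forall x, c <= f x) -> c <= avg f.
Proof. by move=> h; rewrite -[leLHS](avg_const c x) ler_avg. Qed.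

Lemma avgD T (f g : T -> R) : \avg_(x : T) (f x + g x) = avg f + avg g.
Proof. by rewrite /avg big_split mulrDl. Qed.

Lemma avgN T (f : T -> R) : \avg_(x : T) (- f x) = - avg f.
Proof. by rewrite /avg sumrN mulNr. Qed.

Lemma avgB T (f g : T -> R) : \avg_(x : T) (f x - g x) = avg f - avg g.
Proof. by rewrite avgD avgN. Qed.

Lemma avgZ T (f : T -> R) c : \avg_(x : T) (c * f x) = c * avg f.
Proof. by rewrite /avg -mulr_sumr mulrA. Qed.

Lemma avgC T S (f : T -> S -> R) :
  \avg_(x : T) \avg_(y : S) f x y = \avg_(y : S) \avg_(x : T) f x y.
Proof.
rewrite /avg -!mulr_suml exchange_big /=.
by rewrite -!mulrA [_^-1 * _]mulrC.
Qed.

Lemma avg_pair T S (f : T -> S -> R) :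
  \avg_(x : T) \avg_(y : S) f x y = \avg_(p : T * S) f p.1 p.2.
Proof.
rewrite /avg -mulr_suml pair_bigA /= card_prod natrM invfM.
by rewrite -mulrA [_^-1 * _]mulrC.
Qed.

Lemma avg_bij T S (h : S -> T) (f : T -> R) :
  bijective h -> avg f = \avg_(x : S) f (h x).
Proof.
move=> bh; rewrite /avg (reindex h) /=; last by apply: onW_bij.
by rewrite (bij_eq_card bh).
Qed.

Lemma avg2_bij T1 T2 S1 S2 (h : S1 * S2 -> T1 * T2) (f : T1 -> T2 -> R) :
  bijective h -> \avg_(x : T1) \avg_(y : T2) f x y =
    \avg_(x : S1) \avg_(y : S2) f (h (x, y)).1 (h (x, y)).2.
Proof.
by move=> bh; rewrite !avg_pair (avg_bij _ bh); apply: eq_avg => -[].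
Qed.

Lemma avg_ex_ge T (f : T -> R) (x0 : T) : exists x, avg f <= f x.
Proof.
apply: contrapT => h.
have {}h x : f x < avg f.
  by rewrite ltNge; apply/negP => hx; apply: h; exists x.
have T0 : (0 : R) < #|T|%:R.
  by rewrite ltr0n; apply/card_gt0P; exists x0.
suff : \sum_x f x < \sum_(x : T) avg f.
  rewrite sumr_const -[avg f *+ _]mulr_natr divfK ?ltxx //.
  by rewrite gt_eqF.
by apply: ltr_sum => //; apply/hasP; exists x0; rewrite ?mem_index_enum.
Qed.

Lemma avg_ex_le T (f : T -> R) (x0 : T) : exists x, f x <= avg f.
Proof.
have [x] := avg_ex_ge (fun x => - f x) x0; rewrite avgN lerN2 => hx.
by exists x.
Qed.

Lemma avg_eq1 T (c : T) : \avg_(x : T) ((x == c)%:R : R) = #|T|%:R^-1.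
Proof.
rewrite /avg (bigD1 c) //= eqxx big1 ?addr0 ?mul1r // => x.
by move/negbTE ->.
Qed.

Lemma avg_sqr T (f : T -> R) (x0 : T) : avg f ^+ 2 <= \avg_(x : T) f x ^+ 2.
Proof.
rewrite -subr_ge0.
have -> : avg (fun x => f x ^+ 2) - avg f ^+ 2 = \avg_(x : T) (f x - avg f) ^+ 2.
  transitivity (\avg_(x : T) (f x ^+ 2 + (- (2 * avg f)) * f x + avg f ^+ 2)).
    by rewrite !avgD avgZ (avg_const _ x0); ring.
  by apply: eq_avg => x; ring.
by apply: avg_ge0 => x; exact: sqr_ge0.
Qed.

Lemma avg_card T (P : pred T) : \avg_(x : T) ((P x)%:R : R) = #|P|%:R / #|T|%:R.
Proof.
by rewrite /avg -natr_sum -sum1_card [in RHS]big_mkcond /=.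
Qed.

Lemma avgM T S (f : T -> R) (g : S -> R) :
  avg f * avg g = \avg_(x : T) \avg_(y : S) (f x * g y).
Proof.
transitivity (\avg_(x : T) (avg g * f x)); first by rewrite avgZ mulrC.
by apply: eq_avg => x; rewrite avgZ mulrC.
Qed.

Lemma indicator_ge0 (b : bool) : 0 <= (b%:R : R) <= 1.
Proof. by rewrite ler0n lern1 leq_b1. Qed.

Lemma indicator_or (b c e : bool) : (b -> c || e) -> (b%:R : R) <= c%:R + e%:R.
Proof. by rewrite -natrD ler_nat; case: b c e => [] [] [] //= /(_ isT). Qed.

Lemma indicator_and (b c : bool) :
  1 - (~~ b)%:R - (~~ c)%:R <= ((b && c)%:R : R).
Proof. by case: b c => [] [] /=; lra. Qed.

Lemma indicator_neq (T : eqType) (a b c : T) :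
  ((a != c)%:R : R) <= (a != b)%:R + (b != c)%:R.
Proof. by apply: indicator_or; have [->|_] := eqVneq a b. Qed.

End Averages.

(** * Coordinates on planes spanned by two vectors, possibly degenerate *)

Section Plane.
Variables (F : finFieldType).

Definition row2 (a b : F) : 'rV[F]_2 := \row_i (if i == 0 then a else b).

Lemma row2_0 a b : row2 a b 0 0 = a. Proof. by rewrite mxE. Qed.
Lemma row2_1 a b : row2 a b 0 1 = b. Proof. by rewrite mxE. Qed.

Lemma row2P (y z : 'rV[F]_2) : y 0 0 = z 0 0 -> y 0 1 = z 0 1 -> y = z.
Proof.
move=> e0 e1; apply/rowP => i; case: (unliftP 0 i) => [j ->|-> //].
by rewrite (ord1 j) (_ : lift 0 0 = 1) //; apply: val_inj.
Qed.

Lemma row2_bij : bijective (fun p : F * F => row2 p.1 p.2).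
Proof.
exists (fun y : 'rV[F]_2 => (y 0 0, y 0 1)) => [[a b]|y] /=.
  by rewrite row2_0 row2_1.
by apply: row2P; rewrite ?row2_0 ?row2_1.
Qed.

Definition pl m (u v : 'rV[F]_m) (y : 'rV[F]_2) : 'rV[F]_m :=
  y 0 0 *: u + y 0 1 *: v.

Lemma plD m (u v : 'rV[F]_m) y z : pl u v (y + z) = pl u v y + pl u v z.
Proof. by rewrite /pl !mxE !scalerDl addrACA. Qed.

Lemma plZ m (u v : 'rV[F]_m) c y : pl u v (c *: y) = c *: pl u v y.
Proof. by rewrite /pl !mxE scalerDr !scalerA. Qed.

Lemma pl0 m (u v : 'rV[F]_m) : pl u v 0 = 0.
Proof. by rewrite /pl !mxE !scale0r addr0. Qed.

Definition det2 (w w' : 'rV[F]_2) : F := w 0 0 * w' 0 1 - w 0 1 * w' 0 0.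

(** The inverse is given by Cramer's rule. *)
Lemma pl_bij m (w w' : 'rV[F]_2) : det2 w w' != 0 ->
  bijective (fun p : 'rV[F]_m * 'rV[F]_m => (pl p.1 p.2 w, pl p.1 p.2 w')).
Proof.
rewrite /det2; set D := (X in X != 0) => D0.
exists (fun p : 'rV[F]_m * 'rV[F]_m =>
  (D^-1 *: (w' 0 1 *: p.1 - w 0 1 *: p.2),
   D^-1 *: (w 0 0 *: p.2 - w' 0 0 *: p.1))) => [[u v]|[u v]] /=.
  by congr pair; apply/rowP => i; rewrite !mxE /D; field.
by congr pair; apply/rowP => i; rewrite !mxE /D; field.
Qed.

End Plane.

(** * Uniformity of random lines and planes, and second-moment sampling *)

Section Uniformity.
Variables (R : realFieldType) (F : finFieldType).
Local Notation q := (#|F|%:R : R).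

Lemma card_gt0 : 0 < q.
Proof. by rewrite ltr0n; apply/card_gt0P; exists 0. Qed.

Lemma avg_row2 (G : 'rV[F]_2 -> R) :
  avg G = \avg_(a : F) \avg_(b : F) G (row2 a b).
Proof. by rewrite (avg_bij _ (row2_bij F)) avg_pair. Qed.

Variable m : nat.
Local Notation V := 'rV[F]_m.
Implicit Types (G : V -> R).

Lemma avg_shift G a : \avg_(x : V) G (x + a) = avg G.
Proof.
rewrite [RHS](avg_bij (h := fun x => x + a)) //.
by exists (fun x => x - a) => x; rewrite ?addrK ?subrK.
Qed.

Lemma avg_shiftl G a : \avg_(x : V) G (a + x) = avg G.
Proof. by rewrite -[RHS](avg_shift G a); apply: eq_avg => x; rewrite addrC. Qed.

Lemma avg_scale G (c : F) : c != 0 -> \avg_(x : V) G (c *: x) = avg G.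
Proof.
move=> c0; rewrite [RHS](avg_bij (h := fun x => c *: x)) //.
by exists (fun x => c^-1 *: x) => x; rewrite scalerA ?mulVf ?mulfV // scale1r.
Qed.

(** Two distinct parameters on a random line give independent uniform points, because x and u can be
    recovered from the two points. *)
Lemma avg_two_points (G : V -> V -> R) (t t' : F) : t != t' ->
  \avg_(x : V) \avg_(u : V) G (x + t *: u) (x + t' *: u) =
  \avg_(x : V) \avg_(y : V) G x y.
Proof.
move=> tt'; have t0 : t' - t != 0 by rewrite subr_eq0 eq_sym.
rewrite [RHS](avg2_bij (h := fun p : V * V => (p.1 + t *: p.2, p.1 + t' *: p.2))) //.
exists (fun p : V * V => let u := (t' - t)^-1 *: (p.2 - p.1) in (p.1 - t *: u, u)).
  move=> [x u] /=.
  have -> : (t' - t)^-1 *: (x + t' *: u - (x + t *: u)) = u.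
    by apply/rowP => i; rewrite !mxE; field.
  by rewrite addrK.
by move=> [x y] /=; congr pair; apply/rowP => i; rewrite !mxE; field.
Qed.

Lemma avg_planes (G : V -> V -> R) (w w' : 'rV[F]_2) : det2 w w' != 0 ->
  \avg_(u : V) \avg_(v : V) G (pl u v w) (pl u v w') =
  \avg_(u : V) \avg_(v : V) G u v.
Proof.
move=> D0.
by rewrite [RHS](avg2_bij (h := fun p : V * V => (pl p.1 p.2 w, pl p.1 p.2 w'))) //;
  exact: pl_bij.
Qed.

(** One 1/q is for a first coordinate equal to 0; otherwise, given three entries, a single value of
    the last one kills the determinant. *)
Lemma det2_small :
  \avg_(w : 'rV[F]_2) \avg_(w' : 'rV[F]_2) ((det2 w w' == 0)%:R : R) <= 2 / q.
Proof.
rewrite avg_row2.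
apply: (@le_trans _ _ (\avg_(a : F) \avg_(b : F) ((a == 0)%:R + q^-1))); last first.
  under eq_avg do rewrite (avg_const _ 0).
  by rewrite avgD avg_eq1 (avg_const _ 0); lra.
apply: ler_avg => a; apply: ler_avg => b; rewrite avg_row2.
have [->|a0] := eqVneq a 0.
  apply: (@le_trans _ _ 1); last by rewrite lerDl invr_ge0 ltW ?card_gt0.
  by do 2![apply: (avg_le 0) => ?]; rewrite lern1 leq_b1.
rewrite add0r; apply: (avg_le 0) => c.
rewrite -(avg_eq1 R (a^-1 * (b * c))); apply: ler_avg => e.
rewrite /det2 !row2_0 !row2_1 subr_eq0 ler_nat.
by case: eqP => // <-; rewrite mulKf // eqxx.
Qed.

(** Two random vectors of a random plane form a uniform pair unless their coordinates are singular.
    This moves bounds between pairs of independent directions and single planes. *)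
Lemma avg_planes_le (G : V -> V -> R) : (forall u v, 0 <= G u v <= 1) ->
  \avg_(u : V) \avg_(v : V) \avg_(w : 'rV[F]_2) \avg_(w' : 'rV[F]_2)
     G (pl u v w) (pl u v w') <= \avg_(u : V) \avg_(v : V) G u v + 2 / q.
Proof.
move=> hG; pose g := \avg_(u : V) \avg_(v : V) G u v; rewrite -/g.
have -> : \avg_(u : V) \avg_(v : V) \avg_(w : 'rV[F]_2) \avg_(w' : 'rV[F]_2)
     G (pl u v w) (pl u v w') = \avg_(w : 'rV[F]_2) \avg_(w' : 'rV[F]_2)
     \avg_(u : V) \avg_(v : V) G (pl u v w) (pl u v w').
  under eq_avg => u do rewrite avgC.
  rewrite avgC; apply: eq_avg => w.
  under eq_avg => u do rewrite avgC.
  by rewrite avgC.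
apply: (@le_trans _ _ (\avg_(w : 'rV[F]_2) \avg_(w' : 'rV[F]_2)
    (g + (det2 w w' == 0)%:R))); last first.
  under eq_avg do rewrite avgD (avg_const _ 0).
  by rewrite avgD (avg_const _ 0) lerD2l det2_small.
apply: ler_avg => w; apply: ler_avg => w'.
have [_|D0] := eqVneq (det2 w w') 0; last by rewrite avg_planes ?addr0.
apply: (@le_trans _ _ 1).
  apply: (avg_le 0) => u; apply: (avg_le 0) => v.
  by case/andP: (hG (pl u v w) (pl u v w')).
rewrite lerDr; apply: avg_ge0 => u; apply: avg_ge0 => v.
by case/andP: (hG u v).
Qed.

Lemma avg_planes_ge (G : V -> V -> R) : (forall u v, 0 <= G u v <= 1) ->
  \avg_(u : V) \avg_(v : V) G u v <=
  \avg_(u : V) \avg_(v : V) \avg_(w : 'rV[F]_2) \avg_(w' : 'rV[F]_2)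
     G (pl u v w) (pl u v w') + 2 / q.
Proof.
move=> hG; have := @avg_planes_le (fun u v => 1 - G u v).
have e (T : finType) (g : T -> R) (x0 : T) : \avg_(x : T) (1 - g x) = 1 - avg g.
  by rewrite avgB (avg_const _ x0).
have e2 : \avg_(u : V) \avg_(v : V) \avg_(w : 'rV[F]_2) \avg_(w' : 'rV[F]_2)
     (1 - G (pl u v w) (pl u v w')) =
   1 - \avg_(u : V) \avg_(v : V) \avg_(w : 'rV[F]_2) \avg_(w' : 'rV[F]_2)
     G (pl u v w) (pl u v w').
  rewrite -(e _ _ 0); apply: eq_avg => u; rewrite -(e _ _ 0); apply: eq_avg => v.
  by rewrite -(e _ _ 0); apply: eq_avg => w; rewrite -(e _ _ 0).
rewrite e2.
have -> : \avg_(u : V) \avg_(v : V) (1 - G u v) = 1 - \avg_(u : V) \avg_(v : V) G u v.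
  by rewrite -(e _ _ 0); apply: eq_avg => u; rewrite -(e _ _ 0).
move=> h; suff : forall u v, 0 <= 1 - G u v <= 1 by move/h; lra.
by move=> u v; have /andP[] := hG u v => *; apply/andP; split; lra.
Qed.

Section Sampling.
Variable S : V -> bool.
Local Notation s := (\avg_(x : V) ((S x)%:R : R)).
Let dens (x u : V) := \avg_(t : F) ((S (x + t *: u))%:R : R).

Lemma line_density_mean : \avg_(x : V) \avg_(u : V) dens x u = s.
Proof.
transitivity (\avg_(t : F) \avg_(u : V) \avg_(x : V) ((S (x + t *: u))%:R : R)).
  by rewrite [LHS]avgC; under eq_avg do rewrite avgC; rewrite avgC.
under eq_avg => t.
  under eq_avg do rewrite (avg_shift (fun x => (S x)%:R)).
  rewrite (avg_const _ 0); over.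
by rewrite (avg_const _ 0).
Qed.

(** Distinct parameters contribute s^2 by pairwise independence; the diagonal contributes at most
    s/q. *)
Lemma line_density_sqr :
  \avg_(x : V) \avg_(u : V) dens x u ^+ 2 <= s ^+ 2 + s / q.
Proof.
have s0 : 0 <= s by apply: avg_ge0 => x; rewrite ler0n.
rewrite (_ : avg _ = \avg_(t : F) \avg_(t' : F) \avg_(x : V) \avg_(u : V)
   ((S (x + t *: u))%:R * (S (x + t' *: u))%:R : R)); last first.
  have swap (H : V -> V -> F -> F -> R) :
    \avg_(t : F) \avg_(t' : F) \avg_(x : V) \avg_(u : V) H x u t t' =
    \avg_(x : V) \avg_(u : V) \avg_(t : F) \avg_(t' : F) H x u t t'.
    under eq_avg do rewrite avgC.
    rewrite avgC; apply: eq_avg => x.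
    under eq_avg do rewrite avgC.
    by rewrite avgC.
  rewrite swap; apply: eq_avg => x; apply: eq_avg => u.
  by rewrite expr2 avgM.
apply: (@le_trans _ _ (\avg_(t : F) \avg_(t' : F) (s ^+ 2 + s * (t' == t)%:R))).
  apply: ler_avg => t; apply: ler_avg => t'; have [->|tt'] := eqVneq t' t.
    apply: (@le_trans _ _ s); last by rewrite mulr1 lerDr sqr_ge0.
    rewrite avgC.
    apply: (avg_le 0) => u.
    rewrite -(avg_shift (fun x => (S x)%:R) (t *: u)); apply: ler_avg => x.
    by case: (S _); rewrite /= ?mulr1 ?mulr0.
  rewrite (@avg_two_points (fun a b => (S a)%:R * (S b)%:R)) 1?eq_sym //.
  by rewrite mulr0 addr0 -avgM expr2.
rewrite le_eqVlt; apply/orP; left; apply/eqP.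
rewrite -[RHS](avg_const _ (0 : F)); apply: eq_avg => t.
by rewrite avgD (avg_const _ (0 : F)) avgZ avg_eq1.
Qed.

(** Chebyshev's inequality: the variance is at most s/q and the deviation is s/2. *)
Lemma line_sampling : 0 < s ->
  \avg_(x : V) \avg_(u : V) ((dens x u < s / 2)%R%:R : R) <= 4 / (s * q).
Proof.
move=> s0; have q0 := card_gt0.
apply: (@le_trans _ _ (\avg_(x : V) \avg_(u : V)
   (4 / s ^+ 2 * (dens x u ^+ 2 + (- (2 * s)) * dens x u + s ^+ 2)))).
  apply: ler_avg => x; apply: ler_avg => u.
  have -> : dens x u ^+ 2 + (- (2 * s)) * dens x u + s ^+ 2 = (dens x u - s) ^+ 2.
    by ring.
  case: ltP => h /=; last first.
    by apply: mulr_ge0 (sqr_ge0 _); rewrite divr_ge0 // exprn_ge0 // ltW.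
  rewrite -subr_ge0.
  have -> : 4 / s ^+ 2 * (dens x u - s) ^+ 2 - 1 =
     ((dens x u - s) ^+ 2 - s ^+ 2 / 4) * (4 / s ^+ 2) by field; rewrite gt_eqF.
  apply: mulr_ge0; last by rewrite divr_ge0 // exprn_ge0 // ltW.
  by nra.
under eq_avg do rewrite avgZ !avgD avgZ (avg_const _ 0).
rewrite avgZ !avgD avgZ (avg_const _ 0) line_density_mean.
have := line_density_sqr; set a := avg _ => h.
apply: (@le_trans _ _ (4 / s ^+ 2 * (s / q))).
  by rewrite ler_pM2l; [lra | rewrite divr_gt0 // exprn_gt0].
by rewrite le_eqVlt; apply/orP; left; apply/eqP; field; rewrite !gt_eqF.
Qed.

End Sampling.
End Uniformity.

(** The polynomial at (x, u) is read in the parametrisation t |-> x + t u, and the second clause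
    makes it depend on the line only up to translation of t. Direction 0 is included so that an
    oracle pulls back along every plane map. Compatibility with scaling of u is kept apart, since
    the oracles built from best fits are chosen separately for each direction. *)
Definition oracle (F : finFieldType) (m d : nat)
    (P : 'rV[F]_m -> 'rV[F]_m -> {poly F}) : Prop :=
  (forall x u, (size (P x u) <= d.+1)%N) /\
  (forall x u s t, (P (x + s *: u) u).[t] = (P x u).[s + t]).

Definition polyfun (F : finFieldType) (m d : nat) (h : 'rV[F]_m -> F) : Prop :=
  exists2 Q : mpoly.mpoly m F, tdeg_le d Q & forall x, h x = mpeval Q x.

(** * Polynomial identity on lines, averages over cones, dense cores of incidences *)

Section Auxiliary.
Variables (R : realFieldType) (F : finFieldType).
Local Notation q := (#|F|%:R : R).

Lemma poly_eq_on (p r : {poly F}) (k : nat) (S : pred F) :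
  (size p <= k)%N -> (size r <= k)%N -> (k <= #|S|)%N ->
  (forall t, S t -> p.[t] = r.[t]) -> p = r.
Proof.
move=> sp sr kS h; apply/eqP; rewrite -subr_eq0; apply/negP => /negP pr0.
have : all (root (p - r)) (enum S).
  by apply/allP => t; rewrite mem_enum => /h e; rewrite rootE !hornerE e subrr.
move/(max_poly_roots pr0)/(_ (enum_uniq _)); rewrite -cardE ltnNge.
case/negP; apply: leq_trans kS; apply: (leq_trans (size_polyD _ _)).
by rewrite geq_max sp size_polyN.
Qed.

Lemma poly_eq_avg (p r : {poly F}) (d : nat) (S : pred F) :
  (size p <= d.+1)%N -> (size r <= d.+1)%N ->
  d%:R / q < \avg_(t : F) ((S t)%:R : R) ->
  (forall t, S t -> p.[t] = r.[t]) -> p = r.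
Proof.
move=> sp sr h; apply: (poly_eq_on sp sr); move: h.
by rewrite avg_card ltr_pM2r ?invr_gt0 ?card_gt0 // ltr_nat.
Qed.

Variable m : nat.
Local Notation V := 'rV[F]_m.

(** For t != 0 the point x + t u is uniform in u; only t = 0 is special, and it costs 1/q. *)
Lemma avg_cone_le (g : V -> R) (x : V) : (forall y, 0 <= g y <= 1) ->
  \avg_(u : V) \avg_(t : F) g (x + t *: u) <= avg g + q^-1.
Proof.
move=> hg; rewrite avgC.
have g0 : 0 <= avg g by apply: avg_ge0 => y; case/andP: (hg y).
apply: (@le_trans _ _ (\avg_(t : F) (avg g + (t == 0)%:R))); last first.
  by rewrite avgD (avg_const _ 0) avg_eq1.
apply: ler_avg => t; have [->|t0] := eqVneq t 0.
  apply: (@le_trans _ _ 1); last by rewrite lerDr.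
  by apply: (avg_le 0) => u; case/andP: (hg (x + 0 *: u)).
rewrite addr0 (avg_scale (fun u => g (x + u)) t0).
by rewrite (avg_shiftl g).
Qed.

(* Pruning points and lines of low degree from a dense incidence set. The
   maximiser of the potential below is a core with no such point or line. *)
Lemma dense_core (E : {set V * V}) (tau : R) : 0 <= tau ->
  (forall x u, (x, u) \in E -> u != 0) ->
  2 * tau * #|V|%:R ^+ 2 < #|E|%:R ->
  exists E' : {set V * V}, [/\ E' \subset E, E' != set0,
    forall x u, (x, u) \in E' -> tau <= \avg_(v : V) (((x, v) \in E')%:R : R) &
    forall x u, (x, u) \in E' ->
      tau <= \avg_(t : F) (((x + t *: u, u) \in E')%:R : R)].
Proof.
move=> tau0 Eu hE.
pose pts (A : {set V * V}) := [set p.1 | p in A].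
pose sat (A : {set V * V}) := [set p : V * V | [exists t : F, (p.1 + t *: p.2, p.2) \in A]].
(* [sat A] holds q pairs for each line meeting [A]. Removing a poor point loses fewer than tau |V|
   incidences and saves a penalty of tau |V|; emptying a poor line loses fewer than tau q and saves
   tau q. Either would raise [phi]. The maximiser is non-empty because phi(E) > 0: each penalty is
   at most tau |V|^2. *)
pose phi (A : {set V * V}) : R :=
  #|A|%:R - tau * #|V|%:R * #|pts A|%:R - tau * #|sat A|%:R.
have V0 : (0 : R) < #|V|%:R by rewrite ltr0n; apply/card_gt0P; exists 0.
have q0 := card_gt0 R F.
case: (@arg_maxP _ R _ E (fun A => A \subset E) phi (subxx E)) => A sA maxA.
have A0 : A != set0.
  apply/eqP => A0; have := maxA _ (subxx E); rewrite A0.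
  have -> : phi set0 = 0.
    rewrite /phi /pts imset0 !cards0 (_ : sat set0 = set0) ?cards0 ?mulr0 ?subr0 //.
    by apply/setP => p; rewrite !inE; apply/existsP => -[t]; rewrite inE.
  apply/negP; rewrite -ltNge /phi.
  have h1 : (#|pts E|%:R : R) <= #|V|%:R by rewrite ler_nat max_card.
  have h2 : (#|sat E|%:R : R) <= #|V|%:R ^+ 2.
    by rewrite expr2 -natrM -card_prod ler_nat max_card.
  have h3 : tau * #|V|%:R * #|pts E|%:R <= tau * #|V|%:R * #|V|%:R.
    by rewrite ler_wpM2l // mulr_ge0 // ltW.
  have h4 : tau * #|sat E|%:R <= tau * #|V|%:R ^+ 2 by rewrite ler_wpM2l.
  move: hE h3 h4; rewrite !expr2; lra.
have satS (B C : {set V * V}) : B \subset C -> sat B \subset sat C.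
  move=> BC; apply/subsetP => p; rewrite !inE => /existsP[t pt].
  by apply/existsP; exists t; apply: (subsetP BC).
exists A; split => // x u xuA.
- rewrite leNgt; apply/negP => hlt.
  pose X := [set p : V * V | p.1 == x].
  have dX : (#|A :&: X|%:R : R) = #|V|%:R * \avg_(v : V) (((x, v) \in A)%:R : R).
    rewrite avg_card mulrCA divff ?mulr1 ?gt_eqF //; congr (_%:R).
    rewrite -[RHS](card_imset _ (f := fun v : V => (x, v))); last by move=> v v' [].
    apply: eq_card => -[y v]; rewrite !inE; apply/andP/imsetP.
      by move=> [yvA /eqP /= e]; exists v; rewrite ?e // unfold_in -e.
    by move=> [v' xv' [-> ->]].
  have := maxA (A :\: X) (subset_trans (subsetDl _ _) sA).
  have h1 : (#|A :\: X|%:R : R) = #|A|%:R - #|A :&: X|%:R.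
    by rewrite -(cardsID X A) natrD; ring.
  have h2 : (#|pts (A :\: X)|%:R : R) + 1 <= #|pts A|%:R.
    rewrite natr1 ler_nat; apply: proper_card; apply/properP; split.
      by apply: imsetS; apply: subsetDl.
    exists x; first by apply/imsetP; exists (x, u).
    by apply/negP => /imsetP[[y v]]; rewrite !inE /= => /andP[/negbTE yx _] e;
      move: yx; rewrite e eqxx.
  have h3 : (#|sat (A :\: X)|%:R : R) <= #|sat A|%:R.
    by rewrite ler_nat subset_leq_card // satS // subsetDl.
  have h4 : tau * #|V|%:R * (#|pts (A :\: X)|%:R + 1) <= tau * #|V|%:R * #|pts A|%:R.
    by rewrite ler_wpM2l // mulr_ge0 // ltW.
  have h5 : tau * #|sat (A :\: X)|%:R <= tau * #|sat A|%:R by rewrite ler_wpM2l.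
  apply/negP; rewrite -ltNge /phi h1 dX.
  have h6 : #|V|%:R * (\avg_(v : V) (((x, v) \in A)%:R : R)) < #|V|%:R * tau.
    by rewrite ltr_pM2l.
  lra.
- rewrite leNgt; apply/negP => hlt.
  pose L := [set (x + t *: u, u) | t : F].
  have u0 : u != 0 by apply: (Eu x); apply: (subsetP sA).
  have Linj : injective (fun t : F => (x + t *: u, u)).
    move=> t t' [] /addrI /eqP; rewrite -subr_eq0 -scalerBl scaler_eq0 (negbTE u0) orbF.
    by rewrite subr_eq0 => /eqP.
  have cL : #|L| = #|F| by rewrite card_imset.
  have dX : (#|A :&: L|%:R : R) = q * \avg_(t : F) (((x + t *: u, u) \in A)%:R : R).
    rewrite avg_card mulrCA divff ?mulr1 ?gt_eqF //; congr (_%:R).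
    rewrite -[RHS](card_imset _ Linj); apply: eq_card => p; rewrite !inE; apply/andP/imsetP.
      by move=> [pA /imsetP[t _ e]]; exists t; rewrite // unfold_in -e.
    by move=> [t tA ->]; split => //; apply/imsetP; exists t.
  have := maxA (A :\: L) (subset_trans (subsetDl _ _) sA).
  have h1 : (#|A :\: L|%:R : R) = #|A|%:R - #|A :&: L|%:R.
    by rewrite -(cardsID L A) natrD; ring.
  have h2 : (#|pts (A :\: L)|%:R : R) <= #|pts A|%:R.
    by rewrite ler_nat subset_leq_card // imsetS // subsetDl.
  have LA : L \subset sat A.
    apply/subsetP => _ /imsetP[t _ ->]; rewrite inE; apply/existsP; exists (- t) => /=.
    by rewrite scaleNr addrK.
  have h3 : (#|sat (A :\: L)|%:R : R) + q <= #|sat A|%:R.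
    rewrite -natrD ler_nat -cL -(cardsID L (sat A)) (setIidPr LA) addnC leq_add2l.
    apply: subset_leq_card; apply/subsetP => p; rewrite !inE => /existsP[t].
    rewrite !inE => /andP[nL pA]; apply/andP; split; last by apply/existsP; exists t.
    apply: contra nL => /imsetP[t' _ ->] /=; apply/imsetP; exists (t' + t) => //.
    by rewrite scalerDl addrA.
  have h4 : tau * #|V|%:R * #|pts (A :\: L)|%:R <= tau * #|V|%:R * #|pts A|%:R.
    by rewrite ler_wpM2l // mulr_ge0 // ltW.
  have h5 : tau * (#|sat (A :\: L)|%:R + q) <= tau * #|sat A|%:R by rewrite ler_wpM2l.
  apply/negP; rewrite -ltNge /phi h1 dX.
  have h6 : q * (\avg_(t : F) (((x + t *: u, u) \in A)%:R : R)) < q * tau.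
    by rewrite ltr_pM2l.
  lra.
Qed.

End Auxiliary.

(** * The line test in a plane *)

Module PlaneTest.
Import mpoly Algebra Interpolation.

Section PlaneMonomials.
Variables (k n d : nat).

Definition pmon (p : 'I_k * ('I_n * 'I_n)) : 'X_{1..3} :=
  [multinom [tuple nat_of_ord p.1; nat_of_ord p.2.1; nat_of_ord p.2.2]].

Lemma pmon_inj : injective pmon.
Proof.
move=> [c [a b]] [c' [a' b']] e.
have e0 := congr1 (fun m : 'X_{1..3} => nth 0%N m 0) e.
have e1 := congr1 (fun m : 'X_{1..3} => nth 0%N m 1) e.
have e2 := congr1 (fun m : 'X_{1..3} => nth 0%N m 2) e.
by move: e0 e1 e2 => /= /val_inj -> /val_inj -> /val_inj ->.
Qed.

(** The weighted degree bounds the degree in t once Z becomes a polynomial of degree d and X, Y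
    become linear. *)
Definition pweight (i : 'I_3) : nat := if i == ord0 then d else 1.

Lemma pmon_weight p : (0 < k)%N -> (0 < n)%N ->
  (\sum_i pmon p i * pweight i <= k.-1 * d + 2 * n.-1)%N.
Proof.
move=> k0 n0; rewrite !big_ord_recl big_ord0 /pweight /= !muln1 addn0.
rewrite /fun_of_multinom /= !(tnth_nth 0%N) /=.
case: p => [[c hc] [[a ha] [b hb]]] /=.
have hcd : (c * d <= k.-1 * d)%N by rewrite leq_mul2r; apply/orP; right; lia.
by move: hcd; lia.
Qed.

End PlaneMonomials.

Section PlaneTest.
Variables (R : archiRealFieldType) (F : finFieldType).
Local Notation q := (#|F|%:R : R).
Local Notation W := 'rV[F]_2.

(** With about 4/eps^2 powers of Z and eps q/2 powers of each of X and Y there are more than q^2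
    monomials, one condition being imposed per point of the plane. The weight is at most 4d/eps^2 +
    eps q, which the hypothesis on d keeps below 2 eps q. *)
Lemma plane_vanishing (f : W -> F) (d : nat) (eps : R) :
  0 < eps -> eps <= 1 -> 72 * d%:R <= eps ^+ 3 * q ->
  exists (D : nat) (A : {mpoly F[3]}), [/\ D%:R < 2 * eps * q, A != 0,
    {in msupp A, forall m : 'X_{1..3}, (\sum_i m i * pweight d i <= D)%N} &
    forall x, A.@[gpt x (f x)] = 0].
Proof.
move=> e0 e1 hd; have q0 := card_gt0 R F.
pose n := (Num.truncn (eps * q / 2)).+1; pose k := (Num.truncn (4 / eps ^+ 2)).+1.
have eq0 : 0 <= eps * q / 2 by rewrite divr_ge0 // mulr_ge0 // ltW.
have ek0 : 0 <= 4 / eps ^+ 2 by rewrite divr_ge0 // exprn_ge0 // ltW.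
have /andP[n1 n2] : (n.-1%:R <= eps * q / 2) && (eps * q / 2 < n%:R).
  exact: truncn_itv.
have /andP[k1 k2] : (k.-1%:R <= 4 / eps ^+ 2) && (4 / eps ^+ 2 < k%:R).
  exact: truncn_itv.
pose s := [seq pmon p | p : 'I_k * ('I_n * 'I_n)].
have us : uniq s by rewrite map_inj_uniq ?enum_uniq //; exact: pmon_inj.
have ss : size s = (k * (n * n))%N.
  by rewrite size_map -cardE !card_prod !card_ord.
have [|A [A0 sA vA]] := @interpolation F 3 _ (fun x : W => gpt x (f x)) s us.
  rewrite ss card_mx mul1n -(ltr_nat R) natrX !natrM.
  have h : q ^+ 2 = 4 / eps ^+ 2 * (eps * q / 2 * (eps * q / 2)).
    by field; rewrite gt_eqF.
  by rewrite h; apply: (ltr_pM ek0 (mulr_ge0 eq0 eq0) k2); apply: ltr_pM.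
exists (k.-1 * d + 2 * n.-1)%N, A; split=> //.
  rewrite natrD !natrM.
  have : k.-1%:R * d%:R <= eps * q / 18.
    apply: (@le_trans _ _ (4 / eps ^+ 2 * d%:R)); first by rewrite ler_wpM2r.
    have -> : eps * q / 18 = 4 / eps ^+ 2 * (eps ^+ 3 * q / 72).
      by field; rewrite gt_eqF.
    by rewrite ler_wpM2l //; lra.
  have : 0 < eps * q by rewrite mulr_gt0.
  by lra.
by move=> m /sA /mapP[p _ ->]; apply: pmon_weight.
Qed.

Lemma avg_hyperplane (a b : F) : (a != 0) || (b != 0) ->
  \avg_(u : W) ((a * u 0 0 + b * u 0 1 == 0)%:R : R) <= q^-1.
Proof.
rewrite avg_row2; have [->|a0 _] := eqVneq a 0 => /= [b0|].
  apply: (avg_le 0) => c; rewrite -(avg_eq1 R (0 : F)); apply: ler_avg => e.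
  rewrite row2_0 row2_1 mul0r add0r mulf_eq0 (negbTE b0); exact: lexx.
rewrite avgC; apply: (avg_le 0) => c.
rewrite -(avg_eq1 R (- (a^-1 * (b * c)))); apply: ler_avg => e.
rewrite row2_0 row2_1 addr_eq0 ler_nat; case: eqP => // h.
by rewrite -[e](mulKf a0) h mulrN eqxx.
Qed.

(** [E] may be any part of the agreeing incidences, and h is tied to [E] by a line of [E] on which
    it equals the oracle. The list decoding below applies this to the incidences that the list does
    not yet explain. *)
Theorem plane_test (d : nat) (f : W -> F) (P : W -> W -> {poly F})
    (E : W -> W -> bool) (eps : R) :
  (0 < d)%N -> 0 < eps -> eps <= 1 -> 72 * d%:R <= eps ^+ 3 * q ->
  oracle d P -> (forall x u, E x u -> f x = (P x u).[0]) ->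
  5 * eps <= \avg_(x : W) \avg_(u : W) ((E x u)%:R : R) ->
  exists h, [/\ polyfun d h,
    exists x u, E x u /\ forall t, (P x u).[t] = h (x + t *: u) &
    eps ^+ 2 <= \avg_(y : W) (([exists u, E y u] && (f y == h y))%:R : R)].
Proof.
move=> d0 e0 e1 hd [sP cP] fE hE; have q0 := card_gt0 R F.
have d1 : (1 : R) <= d%:R by rewrite ler1n.
have qe : 72 <= eps ^+ 2 * q.
  have : eps ^+ 3 * q <= eps ^+ 2 * q.
    by rewrite ler_wpM2r ?(ltW q0) // exprS ger_pMl // exprn_gt0.
  by lra.
have qe1 : 72 <= eps * q.
  have : eps ^+ 2 * q <= eps * q by rewrite ler_wpM2r ?(ltW q0) // exprS ger_pMl.
  by lra.
have q1 : 72 <= q.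
  have : eps * q <= q by rewrite ger_pMl.
  by lra.
pose E0 := [set p : W * W | E p.1 p.2 & p.2 != 0].
have N0 : (0 : R) < #|{: W}|%:R by rewrite ltr0n; apply/card_gt0P; exists 0.
(* Discarding direction 0 costs q^-2 < eps, so more than 4 eps of the 5 eps is left, twice the core
   threshold 2 eps. *)
have cE0 : 2 * (2 * eps) * #|{: W}|%:R ^+ 2 < #|E0|%:R.
  have h1 : \avg_(x : W) \avg_(u : W) ((E x u)%:R : R) <=
     \avg_(x : W) \avg_(u : W) ((((x, u) \in E0)%:R : R) + (u == 0)%:R).
    apply: ler_avg => x; apply: ler_avg => u; rewrite inE /=.
    by case: (E x u); case: (u == 0) => /=; lra.
  have h2 : \avg_(x : W) \avg_(u : W) ((((x, u) \in E0)%:R : R) + (u == 0)%:R) =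
     #|E0|%:R / #|{: W}|%:R ^+ 2 + #|{: W}|%:R^-1.
    under eq_avg do rewrite avgD avg_eq1.
    rewrite avgD (avg_const _ 0) avg_pair; congr (_ + _).
    rewrite (avg_card R (fun p : W * W => (p.1, p.2) \in E0)) card_prod natrM expr2.
    by congr (_%:R / _); apply: eq_card => -[].
  have h3 : (#|{: W}|%:R : R) = q ^+ 2 by rewrite card_mx mul1n natrX.
  have h4 : (#|{: W}|%:R^-1 : R) < eps.
    rewrite h3 -[ltLHS]mul1r ltr_pdivrMr ?exprn_gt0 // expr2 mulrA.
    by nra.
  rewrite -ltr_pdivlMr ?exprn_gt0 //; lra.
have [E' [sE' E'0 ptE' lnE']] : exists E' : {set W * W}, [/\ E' \subset E0, E' != set0,
    forall x u, (x, u) \in E' -> 2 * eps <= \avg_(v : W) (((x, v) \in E')%:R : R) &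
    forall x u, (x, u) \in E' ->
      2 * eps <= \avg_(t : F) (((x + t *: u, u) \in E')%:R : R)].
  apply: dense_core => //; first by rewrite mulr_ge0 // ltW.
  by move=> x u; rewrite inE => /andP[].
have E'E x u : (x, u) \in E' -> E x u.
  by move=> /(subsetP sE'); rewrite inE => /andP[].
have [D [A0 [hD A00 wA0 vA0]]] := plane_vanishing f e0 e1 hd.
pose T v := exists x u, (x, u) \in E' /\ v = gpt x (f x).
have T0 : exists v, T v.
  by have /set0Pn[[x u] xu] := E'0; exists (gpt x (f x)), x, u.
have [A [wA vA minA [i0 Ai0]]] := @minimal_vanishing F 3 (pweight d) D T T0 A0 A00 wA0
  (ltac:(by move=> _ [x [u [_ ->]]])).
have lineA x u : (x, u) \in E' -> subst_poly (gpar x u (P x u)) A = 0.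
  move=> xu; apply: (@poly_eq_avg R F _ _ D (fun t => (x + t *: u, u) \in E')).
  - apply: (size_subst_poly (w := pweight d)) => // i; rewrite /gpar /pweight.
    case: (unliftP ord0 i) => [j ->|-> //].
    by rewrite eq_sym (negbTE (neq_lift _ _)) size_lpar.
  - by rewrite size_poly0.
  - by apply: lt_le_trans (lnE' x u xu); rewrite ltr_pdivrMr.
  - move=> t xtu; rewrite horner0 horner_gpar; apply: vA.
    exists (x + t *: u), u; split => //; congr gpt.
    by rewrite (fE _ _ (E'E _ _ xtu)) cP addr0.
(* Otherwise minimality gives A_Z = 0, and differentiating A = 0 along core lines makes (A_X, A_Y)
   orthogonal to every core direction. A core point has a fraction 2 eps > 1/q of these, while a
   non-zero vector is orthogonal to at most 1/q of all directions. So all partial derivatives vanish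
   on T, hence are zero by minimality, against the choice of A. *)
have [x [u [xu Az]]] : exists x u, (x, u) \in E' /\ (A^`M(ord0)).@[gpt x (f x)] != 0.
  apply: contrapT => hz.
  have Az0 : A^`M(ord0) = 0.
    apply: minA => _ [x [u [xu ->]]]; apply: contrapT => /eqP ne.
    by apply: hz; exists x, u.
  move: Ai0; case: (unliftP ord0 i0) => [j ->|->]; last by rewrite Az0 eqxx.
  case/negP; apply/eqP; apply: minA => _ [x [u [xu ->]]].
  pose gr l := (A^`M(lift ord0 l)).@[gpt x (f x)].
  have grad v : (x, v) \in E' -> gr 0 * v 0 0 + gr 1 * v 0 1 = 0.
    move=> xv; have := congr1 (fun p : {poly F} => p^`().[0]) (lineA x v xv).
    rewrite /= deriv0 horner0 deriv_subst_poly big_ord_recl Az0 rmorph0 mul0r add0r.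
    rewrite horner_sum !big_ord_recl big_ord0 addr0 => <-.
    have e l : (subst_poly (gpar x v (P x v)) A^`M(lift ord0 l) *
                (gpar x v (P x v) (lift ord0 l))^`()).[0] = gr l * v 0 l.
      rewrite hornerM horner_gpar scale0r addr0 /gpar liftK /lpar.
      rewrite derivD derivC derivZ derivX add0r alg_polyC hornerC.
      by rewrite -(fE _ _ (E'E _ _ xv)).
    by rewrite !e; congr (_ + gr _ * v _ _); apply: val_inj.
  have gr0 : gr 0 = 0 /\ gr 1 = 0.
    apply: contrapT => ne; have ne' : (gr 0 != 0) || (gr 1 != 0).
      by apply/negPn; rewrite negb_or !negbK; apply/negP => /andP[/eqP ? /eqP ?]; apply: ne.
    have := ptE' x u xu; apply/negP; rewrite -ltNge.
    apply: (@le_lt_trans _ _ q^-1).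
      apply: le_trans (avg_hyperplane ne'); apply: ler_avg => v; rewrite ler_nat.
      by case: (boolP (_ \in E')) => // /grad ->; rewrite eqxx.
    by rewrite -[ltRHS]mul1r -[q^-1]mul1r ltr_pdivrMr // mul1r; lra.
  case: gr0 => g0 g1; case: (unliftP 0 j) => [l ->|-> //].
  by rewrite (ord1 l) (_ : lift 0 0 = 1) //; apply: val_inj.
have [Q sQ hQ] := hensel_lines d Az.
have PQ v : (x, v) \in E' -> forall t, (P x v).[t] = mpeval Q (x + t *: v).
  move=> xv t; rewrite /mpeval -horner_lpar_subst; congr (_.[t]).
  apply/polyP => i; have [id|id] := leqP i d.
    by apply: (hQ v) => //; rewrite ?lineA // -(fE _ _ (E'E _ _ xv)).
  rewrite !nth_default //; first by apply: leq_trans (size_lpar_subst _ _ sQ) id.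
  exact: leq_trans (sP _ _) id.
exists (mpeval Q); split.
- by exists Q.
- by exists x, u; split; [exact: E'E | exact: PQ].
set g := fun y => _.
have := @avg_cone_le R F 2 g x (ltac:(by move=> y; rewrite /g ler0n lern1 leq_b1)).
(* A fraction 2 eps of the directions at x, with a fraction 2 eps of core points on each line;
   passing from the cone to the plane costs only 1/q. *)
suff : 4 * eps ^+ 2 <= \avg_(v : W) \avg_(t : F) g (x + t *: v).
  have : q^-1 <= eps ^+ 2.
    by rewrite -[leLHS]mul1r ler_pdivrMr //; lra.
  have : 0 < eps ^+ 2 by rewrite exprn_gt0.
  lra.
apply: (@le_trans _ _ (\avg_(v : W) (2 * eps * ((x, v) \in E')%:R))).
  rewrite avgZ; have := ptE' x u xu; set z := avg _ => hz.
  have : (2 * eps) * (2 * eps) <= 2 * eps * z by rewrite ler_wpM2l //; lra.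
  by rewrite expr2; lra.
apply: ler_avg => v; case: (boolP (_ \in E')) => xv; last first.
  by rewrite mulr0; apply: avg_ge0 => t; rewrite /g ler0n.
rewrite mulr1; apply: (le_trans (lnE' x v xv)); apply: ler_avg => t.
rewrite /g ler_nat; case: (boolP (_ \in E')) => // xtv.
rewrite -PQ // (fE _ _ (E'E _ _ xtv)) cP addr0 eqxx andbT.
by rewrite (_ : [exists u0, _]) //; apply/existsP; exists v; apply: E'E.
Qed.

End PlaneTest.
End PlaneTest.

(** * Functions given by polynomials, and degree bounds from restrictions to lines *)

Module PolyFun.
Import mpoly Algebra.

Section PolyFun.
Variable F : finFieldType.

Section Closure.
Variable m : nat.
Implicit Types (g h : 'rV[F]_m -> F) (a b d : nat).

Lemma polyfun_line d h x u : polyfun d h ->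
  exists2 p : {poly F}, (size p <= d.+1)%N & forall t, h (x + t *: u) = p.[t].
Proof.
move=> [Q sQ hQ]; exists (subst_poly (lpar x u) Q); first exact: size_lpar_subst.
by move=> t; rewrite horner_lpar_subst hQ.
Qed.

Lemma eq_polyfun d g h : g =1 h -> polyfun d g -> polyfun d h.
Proof. by move=> e [Q sQ hQ]; exists Q => // x; rewrite -e. Qed.

Lemma polyfun_const d (c : F) : polyfun d (fun _ : 'rV[F]_m => c).
Proof.
by exists c%:MP => [|x]; rewrite ?/mpeval ?mevalC // /tdeg_le mmeasureC (leq_trans (leq_b1 _)).
Qed.

Lemma polyfun_coord i : polyfun 1 (fun x : 'rV[F]_m => x 0 i).
Proof.
by exists 'X_i => [|x]; rewrite ?/mpeval ?mevalXU // /tdeg_le msizeX mdeg1.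
Qed.

Lemma polyfunD d g h : polyfun d g -> polyfun d h -> polyfun d (fun x => g x + h x).
Proof.
move=> [Q sQ hQ] [Q' sQ' hQ']; exists (Q + Q') => [|x].
  by apply: (leq_trans (mmeasureD_le _ _ _)); rewrite geq_max; apply/andP.
by rewrite hQ hQ' /mpeval mevalD.
Qed.

Lemma polyfunM a b g h :
  polyfun a g -> polyfun b h -> polyfun (a + b) (fun x => g x * h x).
Proof.
move=> [Q sQ hQ] [Q' sQ' hQ']; exists (Q * Q') => [|x]; first exact: msize_mul_le.
by rewrite hQ hQ' /mpeval mevalM.
Qed.

Lemma leq_polyfun a b g : (a <= b)%N -> polyfun a g -> polyfun b g.
Proof. by move=> ab [Q sQ hQ]; exists Q => //; apply: leq_trans sQ _. Qed.

Lemma polyfun_sum (I : Type) (r : seq I) (G : I -> 'rV[F]_m -> F) d :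
  (forall i, polyfun d (G i)) -> polyfun d (fun x => \sum_(i <- r) G i x).
Proof.
move=> hG; elim: r => [|i r IH].
  by apply: eq_polyfun (polyfun_const d 0) => x; rewrite big_nil.
by apply: eq_polyfun (polyfunD (hG i) IH) => x; rewrite big_cons.
Qed.

Lemma polyfun_exp a g k : polyfun a g -> polyfun (a * k) (fun x => g x ^+ k).
Proof.
move=> hg; elim: k => [|k IH].
  by apply: eq_polyfun (polyfun_const _ 1) => x; rewrite expr0.
by rewrite mulnS; apply: eq_polyfun (polyfunM hg IH) => x; rewrite exprS.
Qed.

Lemma polyfun_horner a d g (p : {poly F}) : (size p <= d.+1)%N ->
  polyfun a g -> polyfun (a * d) (fun x => p.[g x]).
Proof.
move=> sp hg.
apply: eq_polyfun (_ : polyfun _ (fun x => \sum_(i < d.+1) p`_i * g x ^+ i)).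
  by move=> x; rewrite (horner_coef_wide _ sp).
apply: polyfun_sum => i; apply: (@leq_polyfun (0 + a * i)).
  by rewrite leq_mul2l -ltnS ltn_ord orbT.
by apply: polyfunM; [exact: polyfun_const | exact: polyfun_exp].
Qed.

(** As 2d < q, the restriction of Q to a line through 0 is determined by its values, so it has
    degree at most d. The Taylor parts of Q above degree d can therefore be dropped. *)
Lemma polyfun_of_double d g : (2 * d < #|F|)%N -> polyfun (2 * d) g ->
  (forall u, exists2 p : {poly F}, (size p <= d.+1)%N & forall t, g (t *: u) = p.[t]) ->
  polyfun d g.
Proof.
move=> dq [Q sQ hQ] hl; have [G hG] := taylor_parts 0 Q.
exists (\sum_(k < d.+1) G k).
  apply: (leq_trans (mmeasure_sum _ _ _ _)); apply/bigmax_leqP => k _.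
  by apply: leq_trans (hG k).1 _.
move=> u; have [p sp hp] := hl u.
have e : subst_poly (lpar 0 u) Q = p.
  apply: (@poly_eq_on F _ _ (2 * d).+1 predT).
  - exact: size_lpar_subst.
  - by apply: leq_trans sp _; rewrite ltnS leq_pmull.
  - exact: dq.
  - by move=> t _; rewrite horner_lpar_subst -hp hQ add0r.
rewrite -[u]scale1r hp scale1r (horner_coef_wide _ sp) /mpeval raddf_sum /=.
apply: eq_bigr => k _; rewrite expr1n mulr1 -e.
have := congr1 (fun r : {poly F} => r.[1]) ((hG k).2 u).
rewrite /= horner_lpar_subst hornerZ hornerXn expr1n mulr1 => <-.
by apply: meval_eq => i; rewrite scale1r add0r.
Qed.

End Closure.

Definition rcons0 m (s : F) (x : 'rV[F]_m) : 'rV[F]_m.+1 :=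
  \row_i (if unlift ord0 i is Some j then x 0 j else s).

Definition rtail m (y : 'rV[F]_m.+1) : 'rV[F]_m := \row_j y 0 (lift ord0 j).

Lemma rcons0_tail m (y : 'rV[F]_m.+1) : rcons0 (y 0 ord0) (rtail y) = y.
Proof.
apply/rowP => i; rewrite mxE; case: unliftP => [j ->|->] //; by rewrite mxE.
Qed.

Lemma rcons0D m s s' (x x' : 'rV[F]_m) t :
  rcons0 (s + t * s') (x + t *: x') = rcons0 s x + t *: rcons0 s' x'.
Proof. by apply/rowP => i; rewrite !mxE; case: unlift => // j; rewrite !mxE. Qed.

Lemma polyfun_tail m d (h : 'rV[F]_m -> F) :
  polyfun d h -> polyfun d (fun y : 'rV[F]_m.+1 => h (rtail y)).
Proof.
move=> [Q sQ hQ].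
pose M (k : 'X_{1..m}) (y : 'rV[F]_m.+1) : F :=
  if k \in msupp Q then Q@_k * \prod_j y 0 (lift ord0 j) ^+ k j else 0.
apply: eq_polyfun (_ : polyfun d (fun y => \sum_(k <- msupp Q) M k y)).
  move=> y; rewrite hQ /mpeval mevalE !big_seq; apply: eq_bigr => k kQ.
  by rewrite /M kQ; congr (_ * _); apply: eq_bigr => j _; rewrite mxE.
apply: polyfun_sum => k; rewrite /M; case kQ: (k \in msupp Q); last exact: polyfun_const.
have kd : (mdeg k <= d)%N by have := leq_trans (msize_mdeg_lt kQ) sQ; rewrite ltnS.
apply: (@leq_polyfun _ (0 + mdeg k)) => //; apply: polyfunM; first exact: polyfun_const.
rewrite mdegE; elim: (index_enum _) => [|j r IH].
  by rewrite big_nil; apply: eq_polyfun (polyfun_const _ _ 1) => y; rewrite big_nil.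
rewrite big_cons.
have := polyfunM (polyfun_exp (k j) (polyfun_coord (lift ord0 j))) IH.
by rewrite mul1n; apply: eq_polyfun => y; rewrite big_cons.
Qed.

Lemma lagrange (d : nat) : (d < #|F|)%N ->
  exists (a : 'I_d.+1 -> F) (L : 'I_d.+1 -> {poly F}),
    (forall i, (size (L i) <= d.+1)%N) /\
    forall (p : {poly F}) s, (size p <= d.+1)%N ->
      p.[s] = \sum_i p.[a i] * (L i).[s].
Proof.
move=> dq; pose a (i : 'I_d.+1) := enum_val (widen_ord dq i).
have ainj : injective a.
  by move=> i j /enum_val_inj /(congr1 val) /= e; apply: val_inj.
pose L i := \prod_(j | j != i) ((a i - a j)^-1 *: ('X - (a j)%:P)).
have sL i : (size (L i) <= d.+1)%N.
  rewrite /L; apply: leq_trans (size_prod_leq _ _) _.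
  have -> : #|(fun j : 'I_d.+1 => j != i)| = d.
    by have := cardC1 i; rewrite card_ord.
  rewrite leq_subLR addnS ltnS.
  apply: (@leq_trans (\sum_(j < d.+1 | j != i) 2)).
    apply: leq_sum => j _; apply: leq_trans (size_scale_leq _ _) _.
    by rewrite size_XsubC.
  rewrite sum_nat_const (_ : #|_| = d); last by have := cardC1 i; rewrite card_ord.
  by rewrite muln2 -addnn.
have La i j : (L i).[a j] = (i == j)%:R.
  rewrite /L horner_prod; have [->|ij] := eqVneq i j.
    rewrite big1 // => k kj; rewrite hornerZ hornerXsubC mulVf //.
    by rewrite subr_eq0 (inj_eq ainj) eq_sym.
  by rewrite (bigD1 j) 1?eq_sym //= hornerZ hornerXsubC subrr mulr0 mul0r.
exists a, L; split => // p s sp.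
have -> : p = \sum_i p.[a i] *: L i.
  apply: (@poly_eq_on F _ _ d.+1 [pred t | t \in codom a]) => //.
  - apply: leq_trans (size_sum _ _ _) _; apply/bigmax_leqP => i _.
    by apply: leq_trans (size_scale_leq _ _) _.
  - by rewrite (card_codom ainj) card_ord.
  - move=> t /codomP[j ->]; rewrite horner_sum (bigD1 j) //= big1 => [|i ij].
      by rewrite hornerZ La eqxx mulr1 addr0.
    by rewrite hornerZ La (negbTE ij) mulr0.
rewrite horner_sum; apply: eq_bigr => i _; rewrite hornerZ; congr (_ * _).
rewrite horner_sum (bigD1 i) //= big1 => [|j ji].
  by rewrite hornerZ La eqxx mulr1 addr0.
by rewrite hornerZ La (negbTE ji) mulr0.
Qed.

(* Interpolating in one coordinate gives degree at most 2d; lines through the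
   origin then bound the total degree by d. *)
Theorem polyfun_of_lines m d (g : 'rV[F]_m -> F) : (2 * d < #|F|)%N ->
  (forall x u, exists2 p : {poly F}, (size p <= d.+1)%N &
     forall t, g (x + t *: u) = p.[t]) -> polyfun d g.
Proof.
move=> dq; elim: m g => [|m IH] g hg.
  by apply: eq_polyfun (polyfun_const 0 d (g 0)) => x; rewrite [x]thinmx0.
apply: polyfun_of_double => //; last first.
  move=> u; have [p sp hp] := hg 0 u; exists p => // t.
  by rewrite -hp add0r.
have [|a [L [sL hL]]] := @lagrange d; first by lia.
apply: eq_polyfun
  (_ : polyfun _ (fun y => \sum_i g (rcons0 (a i) (rtail y)) * (L i).[y 0 ord0])).
  move=> y; have [p sp hp] := hg (rcons0 0 (rtail y)) (rcons0 1 0).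
  have e s : g (rcons0 s (rtail y)) = p.[s].
    by rewrite -hp -rcons0D add0r mulr1 scaler0 addr0.
  rewrite -[in RHS](rcons0_tail y) e (hL p _ sp).
  by apply: eq_bigr => i _; rewrite e.
apply: polyfun_sum => i; rewrite mul2n -addnn; apply: polyfunM.
  apply: (@polyfun_tail m d (fun x => g (rcons0 (a i) x))); apply: IH => x u.
  have [p sp hp] := hg (rcons0 (a i) x) (rcons0 0 u); exists p => // t.
  by rewrite -hp -rcons0D mulr0 addr0.
rewrite -[d in polyfun d]mul1n; apply: polyfun_horner => //.
exact: polyfun_coord.
Qed.

End PolyFun.
End PolyFun.

(** * Best fits on lines *)

Section BestFit.
Variables (R : realFieldType) (F : finFieldType) (m : nat).
Local Notation V := 'rV[F]_m.
Local Notation q := (#|F|%:R : R).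

Lemma line_shift (x u : V) s : line (x + s *: u) u = line x u.
Proof.
apply/setP => y; apply/imsetP/imsetP => -[t _ ->].
  by exists (s + t) => //; rewrite scalerDl addrA.
by exists (t - s) => //; rewrite -addrA -scalerDl addrCA subrr addr0.
Qed.

Lemma avg_line_shift (G : V -> V -> R) :
  \avg_(x : V) \avg_(u : V) \avg_(t : F) G (x + t *: u) u =
  \avg_(x : V) \avg_(u : V) G x u.
Proof.
rewrite [LHS]avgC [RHS]avgC; apply: eq_avg => u; rewrite avgC.
rewrite -[RHS](avg_const _ (0 : F)); apply: eq_avg => t.
exact: (avg_shift (fun x => G x u)).
Qed.

Lemma avg_shift_field (g : F -> R) (s : F) : \avg_(t : F) g (t + s) = avg g.
Proof.
rewrite [RHS](avg_bij (h := fun t => t + s)) //.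
by exists (fun t => t - s) => t; rewrite ?addrK ?subrK.
Qed.

(** [Bd y z] says that the value z is wrong at y. An arbitrary predicate serves total functions and
    partial ones, for which no value is wrong outside the domain. *)
Lemma best_fit (Bd : V -> F -> bool) (d : nat) :
  exists2 H : V -> V -> {poly F}, oracle d H &
    forall x u (p : {poly F}), (size p <= d.+1)%N ->
      \avg_(t : F) ((Bd (x + t *: u) (H x u).[t])%:R : R) <=
      \avg_(t : F) (Bd (x + t *: u) p.[t])%:R.
Proof.
pose cost x u (c : 'rV[F]_d.+1) := #|[set t | Bd (x + t *: u) (rVpoly c).[t]]|.
pose best x u := rVpoly [arg min_(c < 0 : 'rV[F]_d.+1) cost x u c].
have bestP x u (p : {poly F}) : (size p <= d.+1)%N ->
    \avg_(t : F) ((Bd (x + t *: u) (best x u).[t])%:R : R) <=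
    \avg_(t : F) (Bd (x + t *: u) p.[t])%:R.
  move=> sp; rewrite !avg_card ler_pM2r ?invr_gt0 ?card_gt0 // ler_nat /best.
  case: arg_minnP => // c _ /(_ (poly_rV p) isT); rewrite /cost !cardsE.
  by rewrite poly_rV_K.
pose best0 x := [arg min_(c < 0 : F) (Bd x c : nat)].
(* A base point depending only on the line as a set: the fit is chosen there once and transported,
   so that it satisfies the translation rule of an oracle. In direction 0 the line is a point, and a
   constant is chosen instead. *)
pose org x u : V := odflt 0 [pick y in line x u].
pose crd x u : F := odflt 0 [pick t | x == org x u + t *: u].
have orgS x u s : org (x + s *: u) u = org x u by rewrite /org line_shift.
have crdP x u : x = org x u + crd x u *: u.
  rewrite /crd; case: pickP => [t /eqP //|h].
  have : org x u \in line x u.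
    rewrite /org; case: pickP => [y //|hn]; move/negbT/negP: (hn x).
    by case; apply/imsetP; exists 0 => //; rewrite scale0r addr0.
  case/imsetP => t _ e; have := h (- t).
  by rewrite e -addrA -scalerDl subrr scale0r addr0 eqxx.
have crdS x u s : u != 0 -> crd (x + s *: u) u = crd x u + s.
  move=> u0; have := crdP (x + s *: u) u; rewrite orgS {1}(crdP x u) -addrA -scalerDl.
  move/addrI/eqP; rewrite -subr_eq0 -scalerBl scaler_eq0 (negbTE u0) orbF subr_eq0.
  by move/eqP.
pose H x u := if u == 0 then (best0 x)%:P
              else best (org x u) u \Po ('X + (crd x u)%:P).
exists H; first split.
- move=> x u; rewrite /H; case: eqP => _; first by rewrite size_polyC (leq_trans (leq_b1 _)).
  by rewrite size_comp_poly2 ?size_poly // size_XaddC.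
- move=> x u s t; rewrite /H; have [->|u0] := eqVneq u 0.
    by rewrite scaler0 addr0 !hornerC.
  rewrite orgS crdS // !horner_comp !hornerD !hornerX !hornerC.
  by rewrite (_ : t + (crd x u + s) = s + t + crd x u) //; ring.
move=> x u p sp; rewrite /H; have [->|u0] := eqVneq u 0.
  apply: ler_avg => t; rewrite hornerC scaler0 addr0 ler_nat /best0.
  by case: arg_minnP => // c _; apply.
set o := org x u; set c := crd x u.
have sp' : (size (p \Po ('X - c%:P)) <= d.+1)%N.
  by rewrite size_comp_poly2 // size_XsubC.
have := bestP o u _ sp'.
rewrite -(avg_shift_field _ c) -[leRHS](avg_shift_field _ c).
have e t : o + (t + c) *: u = x + t *: u by rewrite [in RHS](crdP x u) addrAC -addrA -scalerDl.
under eq_avg do rewrite e.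
under [leRHS]eq_avg do rewrite e horner_comp !hornerE addrK.
by under [in X in _ -> X]eq_avg do rewrite horner_comp !hornerE.
Qed.

Lemma avg_cone_ge (g : V -> R) (x : V) : (forall y, 0 <= g y <= 1) ->
  avg g <= \avg_(u : V) \avg_(t : F) g (x + t *: u) + q^-1.
Proof.
move=> hg; have := @avg_cone_le R F m (fun y => 1 - g y) x.
have e (T : finType) (k : T -> R) (x0 : T) : \avg_(y : T) (1 - k y) = 1 - avg k.
  by rewrite avgB (avg_const _ x0).
rewrite (e _ _ 0); under eq_avg do rewrite (e _ _ 0).
rewrite (e _ _ 0) => h; suff : forall y, 0 <= 1 - g y <= 1 by move/h; lra.
by move=> y; have /andP[] := hg y => *; apply/andP; split; lra.
Qed.

(** On every line through a point z where they differ, the two functions agree at no more than d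
    points; averaging over the cone at z adds 1/q <= d/q. *)
Lemma polyfun_agree d (g h : V -> F) (z : V) : (0 < d)%N ->
  polyfun d g -> polyfun d h -> g z != h z ->
  \avg_(y : V) ((g y == h y)%:R : R) <= 2 * d%:R / q.
Proof.
move=> d0 pg ph gh; have q0 := card_gt0 R F.
apply: (le_trans (avg_cone_ge z (fun y => indicator_ge0 R _))).
have d1 : q^-1 <= d%:R / q by rewrite ler_peMl ?invr_ge0 ?ler1n // ltW.
suff : \avg_(u : V) \avg_(t : F) ((g (z + t *: u) == h (z + t *: u))%:R : R) <= d%:R / q.
  by lra.
apply: (avg_le 0) => u; rewrite leNgt; apply/negP => hlt.
have [p sp hp] := PolyFun.polyfun_line z u pg.
have [r sr hr] := PolyFun.polyfun_line z u ph.
have e : p = r.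
  by apply: (poly_eq_avg sp sr hlt) => t /eqP; rewrite hp hr.
by move: gh; rewrite -[z]addr0 -[0](scale0r u) hp hr e eqxx.
Qed.

End BestFit.

(** * Planes on which an oracle rarely errs *)

Section RobustPlane.
Variables (R : archiRealFieldType) (F : finFieldType).
Local Notation W := 'rV[F]_2.
Local Notation q := (#|F|%:R : R).

(** Since b <= a/2, the agreeing incidences have density a/2 = 5 (a/10), so [plane_test] at a/10
    gives h equal to f on a part S of D of density at least a^2/100. A typical line meets S in many
    points; if H seldom errs there, H and h share more than d points of the line and coincide on
    it. *)
Lemma plane_robust d (D : W -> bool) (f : W -> F) (H : W -> W -> {poly F}) (a b : R) :
  (0 < d)%N -> 0 < a -> a <= 1 -> 72 * 1000 * d%:R <= a ^+ 3 * q -> oracle d H ->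
  a <= \avg_(y : W) ((D y)%:R : R) ->
  \avg_(y : W) \avg_(w : W) ((D y && (f y != (H y w).[0]))%:R : R) <= b ->
  b <= a / 2 ->
  exists2 h, polyfun d h &
    \avg_(y : W) \avg_(w : W) (([exists t, (H y w).[t] != h (y + t *: w)])%:R : R)
      <= 400 * (q^-1 + b) / a ^+ 2.
Proof.
move=> d0 a0 a1 hq oH hD hb ba; have q0 := card_gt0 R F; have [sH cH] := oH.
pose E y w := D y && (f y == (H y w).[0]).
have [||||||h [ph _ hh]] := @PlaneTest.plane_test R F d f H E (a / 10) d0.
- by rewrite divr_gt0.
- by lra.
- have -> : (a / 10) ^+ 3 * q = a ^+ 3 * q / 1000 by field.
  by lra.
- exact: oH.
- by move=> y w /andP[_ /eqP].
- have : \avg_(y : W) \avg_(w : W) ((D y)%:R - (D y && (f y != (H y w).[0]))%:R : R)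
      <= \avg_(y : W) \avg_(w : W) (E y w)%:R.
    apply: ler_avg => y; apply: ler_avg => w; rewrite /E.
    by case: (D y); case: (f y == _) => /=; lra.
  under eq_avg do rewrite avgB (avg_const _ 0).
  by rewrite avgB; lra.
exists h => //; pose S y := D y && (f y == h y).
set s := \avg_(y : W) ((S y)%:R : R).
have hs : a ^+ 2 / 100 <= s.
  have -> : a ^+ 2 / 100 = (a / 10) ^+ 2 by field.
  apply: (le_trans hh); apply: ler_avg => y; rewrite ler_nat /S.
  by case: existsP => // -[u /andP[-> _]].
have s0 : 0 < s by apply: lt_le_trans hs; rewrite divr_gt0 // exprn_gt0.
pose dens y w := \avg_(t : F) ((S (y + t *: w))%:R : R).
pose err y w := \avg_(t : F) ((S (y + t *: w) && (f (y + t *: w) != (H y w).[t]))%:R : R).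
have sampling := line_sampling (S := S) s0; rewrite -/s in sampling.
have herr : \avg_(y : W) \avg_(w : W) err y w <= b.
  apply: le_trans hb.
  rewrite -(avg_line_shift (fun y w => (D y && (f y != (H y w).[0]))%:R)).
  apply: ler_avg => y; apply: ler_avg => w; apply: ler_avg => t.
  by rewrite ler_nat cH addr0 /S; case: (D _); case: (_ == h _); case: (_ == _).
(* A line where H differs from h either samples S badly or has error at least s/4, which is charged
   by Markov's inequality. *)
have key y w : (([exists t, (H y w).[t] != h (y + t *: w)])%:R : R) <=
    (dens y w < s / 2)%R%:R + 4 / s * err y w.
  have err0 : 0 <= err y w by apply: avg_ge0 => t; rewrite ler0n.
  have serr0 : 0 <= 4 / s * err y w.
    by rewrite mulr_ge0 // divr_ge0 // ltW.
  case: existsP => [[t0 ht0]|_]; last by rewrite addr_ge0.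
  case: ltP => [_|hdens] /=; first by lra.
  have [he|he] := leP (s / 4) (err y w).
    rewrite add0r (_ : 1%:R = 4 / s * (s / 4)); last by field; rewrite gt_eqF.
    by rewrite ler_wpM2l // divr_ge0 // ltW.
  case/negP: ht0; have [p sp hp] := PolyFun.polyfun_line y w ph.
  rewrite hp; apply/eqP; congr (_.[t0]).
  apply: (@poly_eq_avg R F _ _ d
    (fun t => S (y + t *: w) && (f (y + t *: w) == (H y w).[t])) (sH _ _) sp).
    apply: (@lt_le_trans _ _ (dens y w - err y w)).
      apply: (@le_lt_trans _ _ (s / 4)); last by lra.
      rewrite ler_pdivrMr //.
      have h1 : a ^+ 2 / 100 * q <= s * q by rewrite ler_wpM2r // ltW.
      have h2 : a ^+ 3 * q <= a ^+ 2 * q.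
        by rewrite ler_wpM2r ?(ltW q0) // exprS ger_pMl // exprn_gt0.
      by have := ler0n R d; lra.
    rewrite -avgB; apply: ler_avg => t.
    by case: (S _); case: (_ == _) => /=; lra.
  by move=> t /andP[/andP[_ /eqP e] /eqP <-]; rewrite e hp.
apply: (@le_trans _ _ (4 / (s * q) + 4 / s * b)).
  apply: (@le_trans _ _ (\avg_(y : W) \avg_(w : W)
     ((dens y w < s / 2)%R%:R + 4 / s * err y w))).
    by apply: ler_avg => y; apply: ler_avg => w; exact: key.
  under eq_avg do rewrite avgD avgZ.
  rewrite avgD avgZ lerD // ler_wpM2l //.
  by rewrite divr_ge0 // ltW.
have b0 : 0 <= b.
  by apply: le_trans hb; apply: avg_ge0 => y; apply: avg_ge0 => w; rewrite ler0n.
have -> : 4 / (s * q) + 4 / s * b = 4 * (q^-1 + b) / s by field; rewrite !gt_eqF.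
rewrite ler_pdivrMr // mulrAC ler_pdivlMr ?exprn_gt0 //.
have : 4 * (q^-1 + b) * (a ^+ 2 / 100) <= 4 * (q^-1 + b) * s.
  by rewrite ler_wpM2l // mulr_ge0 // addr_ge0 // invr_ge0 ltW.
lra.
Qed.

Lemma plane_total d (g : W -> F) (H : W -> W -> {poly F})
    (b := \avg_(y : W) \avg_(w : W) ((g y != (H y w).[0])%:R : R)) :
  (0 < d)%N -> 72 * 1000 * d%:R <= q -> oracle d H ->
  exists2 h, polyfun d h &
    \avg_(y : W) ((g y != h y)%:R : R) <= 401 * (b + q^-1).
Proof.
move=> d0 hq oH; have q0 := card_gt0 R F; have qi : 0 < q^-1 by rewrite invr_gt0.
have b0 : 0 <= b by apply: avg_ge0 => y; apply: avg_ge0 => w; rewrite ler0n.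
have [hb|hb] := leP b (1 / 2); last first.
  exists (fun=> 0); first exact: PolyFun.polyfun_const.
  apply: (@le_trans _ _ 1); last by lra.
  by apply: (avg_le 0) => y; rewrite lern1 leq_b1.
have [||h ph hh] := @plane_robust d xpredT g H 1 b d0 ltr01 (lexx _) _ oH _ (lexx _) hb.
- by rewrite expr1n mul1r.
- by rewrite (avg_const _ 0).
exists h => //; rewrite expr1n divr1 in hh.
have : \avg_(y : W) ((g y != h y)%:R : R) <= \avg_(y : W) \avg_(w : W)
  ((g y != (H y w).[0])%:R + ([exists t, (H y w).[t] != h (y + t *: w)])%:R : R).
  apply: ler_avg => y; apply: (avg_ge 0) => w.
  apply: indicator_or; have [->|//] := eqVneq (g y) (H y w).[0] => /= ne.
  by apply/existsP; exists 0; rewrite scale0r addr0.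
under [leRHS]eq_avg do rewrite avgD.
rewrite avgD -/b; lra.
Qed.

(** The bounds hold for every y0: h is close to g on the whole plane, hence on the cone at any
    point, and a best fit is at least as good as h on each line. If h has error below 1/4 on a line,
    the fit and h agree on more than half of it and so coincide; the factor 4 is Markov's. *)
Lemma plane_best_fit d (g : W -> F) (H : W -> W -> {poly F})
    (b := \avg_(y : W) \avg_(w : W) ((g y != (H y w).[0])%:R : R)) :
  (0 < d)%N -> 72 * 1000 * d%:R <= q -> oracle d H ->
  (forall x u (p : {poly F}), (size p <= d.+1)%N ->
      \avg_(t : F) ((g (x + t *: u) != (H x u).[t])%:R : R) <=
      \avg_(t : F) (g (x + t *: u) != p.[t])%:R) ->
  exists2 h, polyfun d h & forall y0 : W,
   \avg_(w : W) \avg_(t : F) ((g (y0 + t *: w) != (H y0 w).[t])%:R : R)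
      <= 402 * (b + q^-1) /\
   \avg_(w : W) (((H y0 w).[0] != h y0)%:R : R) <= 4 * 402 * (b + q^-1).
Proof.
move=> d0 hq oH bf; have q0 := card_gt0 R F; have qi : 0 < q^-1 by rewrite invr_gt0.
have b0 : 0 <= b by apply: avg_ge0 => y; apply: avg_ge0 => w; rewrite ler0n.
have [h ph hh] := plane_total g d0 hq oH; rewrite -/b in hh.
exists h => // y0.
pose e w := \avg_(t : F) ((g (y0 + t *: w) != h (y0 + t *: w))%:R : R).
have he : avg e <= 402 * (b + q^-1).
  have := avg_cone_le y0 (fun y => indicator_ge0 R (g y != h y)); rewrite -/(avg e).
  lra.
have He w : \avg_(t : F) ((g (y0 + t *: w) != (H y0 w).[t])%:R : R) <= e w.
  have [p sp hp] := PolyFun.polyfun_line y0 w ph.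
  by apply: le_trans (bf y0 w p sp) _; apply: ler_avg => t; rewrite hp.
split; first by apply: le_trans he; apply: ler_avg.
apply: (@le_trans _ _ (\avg_(w : W) (4 * e w))); last first.
  by rewrite avgZ -mulrA ler_wpM2l.
apply: ler_avg => w.
have e0 : 0 <= e w by apply: avg_ge0 => t; rewrite ler0n.
case: eqP => [_|/eqP ne] /=; first by rewrite mulr_ge0.
rewrite leNgt; apply/negP => hlt; case/negP: ne; apply/eqP.
have [p sp hp] := PolyFun.polyfun_line y0 w ph.
have -> : h y0 = p.[0] by rewrite -hp scale0r addr0.
congr (_.[0]); apply: (@poly_eq_avg R F _ _ d
  (fun t => (g (y0 + t *: w) == (H y0 w).[t]) && (g (y0 + t *: w) == h (y0 + t *: w)))
  (oH.1 _ _) sp).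
  apply: (@lt_le_trans _ _ (\avg_(t : F)
     (1 - (g (y0 + t *: w) != (H y0 w).[t])%:R - (g (y0 + t *: w) != h (y0 + t *: w))%:R))).
    rewrite !avgB (avg_const _ 0) -/(e w).
    have : d%:R / q <= 1 / 1000 by rewrite ler_pdivrMr //; lra.
    by have := He w; lra.
  by apply: ler_avg => t; apply: indicator_and.
by move=> t /andP[/eqP <- /eqP ->]; rewrite hp.
Qed.

End RobustPlane.

(** * Line test for total functions with small error *)

Section TotalTest.
Variables (R : archiRealFieldType) (F : finFieldType) (m : nat).
Local Notation V := 'rV[F]_m.
Local Notation W := 'rV[F]_2.
Local Notation q := (#|F|%:R : R).

Lemma pl_line (x u v : V) (y w : W) (t : F) :
  x + pl u v (y + t *: w) = x + pl u v y + t *: pl u v w.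
Proof. by rewrite plD plZ addrA. Qed.

Lemma oracle_pl d (H : V -> V -> {poly F}) (x u v : V) : oracle d H ->
  oracle d (fun y w : W => H (x + pl u v y) (pl u v w)).
Proof.
by move=> [sH cH]; split=> [y w|y w s t]; [exact: sH | rewrite pl_line cH].
Qed.

Lemma avg_pl_transverse (G : V -> R) (a : F) (b : F) (u : V) : b != 0 ->
  \avg_(v : V) G (pl u v (row2 a b)) = avg G.
Proof.
move=> b0; under eq_avg do rewrite /pl row2_0 row2_1.
by rewrite (avg_scale (fun v => G (a *: u + v)) b0) (avg_shiftl G).
Qed.

Lemma avg_plane_lines (G : W -> R) (w : W) : w 0 1 != 0 ->
  avg G = \avg_(s : F) \avg_(t : F) G (row2 s 0 + t *: w).
Proof.
move=> w0; rewrite avg_pair.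
apply: (avg_bij (h := fun p : F * F => row2 p.1 0 + p.2 *: w)).
exists (fun y : W => (y 0 0 - y 0 1 / w 0 1 * w 0 0, y 0 1 / w 0 1)).
  move=> [s t] /=; rewrite !mxE /= add0r mulfK // addrK //.
by move=> y; apply: row2P; rewrite !mxE /=; field.
Qed.

(** Best fits do not increase the average error and, through [plane_best_fit], give bounds at every
    point rather than at typical ones. Only such bounds make the corrected function a polynomial on
    every line without exception. *)
Theorem total_test d (g : V -> F) (H : V -> V -> {poly F})
    (del := \avg_(x : V) \avg_(u : V) ((g x != (H x u).[0])%:R : R) + q^-1) :
  (0 < d)%N -> oracle d H -> 72 * 1000 * d%:R <= q -> 10 ^+ 8 * del <= 1 ->
  exists2 Q : V -> F, polyfun d Q & \avg_(x : V) ((g x != Q x)%:R : R) <= 1 / 100.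
Proof.
move=> d0 oH hq hdel; have q0 := card_gt0 R F.
have qi : 0 < q^-1 by rewrite invr_gt0.
have [B oB bB] := best_fit R (fun y z => g y != z) d; have [sB cB] := oB.
pose err x u := \avg_(t : F) ((g (x + t *: u) != (B x u).[t])%:R : R).
have err01 x u : 0 <= err x u <= 1.
  apply/andP; split; first by apply: avg_ge0 => t; rewrite ler0n.
  by apply: (avg_le 0) => t; rewrite lern1 leq_b1.
have errE : \avg_(x : V) \avg_(u : V) err x u =
   \avg_(x : V) \avg_(u : V) ((g x != (B x u).[0])%:R : R).
  rewrite -[RHS](avg_line_shift (fun x u => (g x != (B x u).[0])%:R)).
  by apply: eq_avg => x; apply: eq_avg => u; apply: eq_avg => t; rewrite cB addr0.
have eta0 : \avg_(x : V) \avg_(u : V) ((g x != (B x u).[0])%:R : R) <= del - q^-1.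
  rewrite -errE /del addrK.
  rewrite -[leRHS](avg_line_shift (fun x u => (g x != (H x u).[0])%:R)).
  apply: ler_avg => x; apply: ler_avg => u; apply: le_trans (bB x u _ (oH.1 x u)) _.
  by apply: ler_avg => t; rewrite oH.2 addr0.
have del0 : q^-1 <= del.
  by rewrite lerDr; apply: avg_ge0 => x; apply: avg_ge0 => u; rewrite ler0n.
pose b x u v := \avg_(y : W) \avg_(w : W)
  ((g (x + pl u v y) != (B (x + pl u v y) (pl u v w)).[0])%:R : R).
have plane x u v : exists2 h : W -> F, polyfun d h & forall y0 : W,
   \avg_(w : W) err (x + pl u v y0) (pl u v w) <= 402 * (b x u v + q^-1) /\
   \avg_(w : W) (((B (x + pl u v y0) (pl u v w)).[0] != h y0)%:R : R)
     <= 4 * 402 * (b x u v + q^-1).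
  have [|h ph hh] := @plane_best_fit R F d (fun y => g (x + pl u v y)) _
      d0 hq (oracle_pl x u v oB).
    move=> y w p sp; have := bB (x + pl u v y) (pl u v w) p sp.
    by under eq_avg do rewrite -pl_line; under [leRHS]eq_avg do rewrite -pl_line.
  exists h => // y0; have [h1 h2] := hh y0; split=> //.
  by apply: le_trans h1; apply: ler_avg => w; rewrite /err;
     under eq_avg do rewrite -pl_line.
have hbx x : \avg_(u : V) \avg_(v : V) b x u v <= del + q^-1.
  have := @avg_planes_le R F m (fun a c => (g (x + a) != (B (x + a) c).[0])%:R)
    (fun u v => indicator_ge0 _ _).
  rewrite (avg_shiftl (fun y => \avg_(v : V) (g y != (B y v).[0])%:R)).
  by rewrite -/(b x); lra.
have err_x x : \avg_(u : V) err x u <= 1300 * del.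
  have := @avg_planes_ge R F m (fun a _ => err x a) (fun u v => err01 x u).
  under eq_avg do rewrite (avg_const _ 0).
  suff : \avg_(u : V) \avg_(v : V) \avg_(w : W) \avg_(w' : W) err x (pl u v w) <=
     402 * (del + 2 * q^-1) by lra.
  apply: (@le_trans _ _ (\avg_(u : V) \avg_(v : V) (402 * (b x u v + q^-1)))).
    apply: ler_avg => u; apply: ler_avg => v; have [h _ /(_ 0)[h1 _]] := plane x u v.
    by rewrite pl0 addr0 in h1; under eq_avg do rewrite (avg_const _ 0).
  under eq_avg do rewrite avgZ avgD (avg_const _ 0).
  by rewrite avgZ avgD (avg_const _ 0) ler_wpM2l //; have := hbx x; clear -qi; lra.
(* On a random plane through x most directions predict the value at x of the plane's polynomial, so
   two random directions usually predict the same value; an average direction then provides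
   [g' x]. *)
have /choice[g' hg'] : forall x, exists z : F,
    \avg_(u : V) (((B x u).[0] != z)%:R : R) <= (100 * 100) * del.
  move=> x.
  have := @avg_planes_ge R F m (fun a c => ((B x a).[0] != (B x c).[0])%:R)
    (fun u v => indicator_ge0 _ _).
  set X := avg _ => hX.
  have : X <= (100 * 100) * del.
    apply: (le_trans hX).
    suff : \avg_(u : V) \avg_(v : V) \avg_(w : W) \avg_(w' : W)
       (((B x (pl u v w)).[0] != (B x (pl u v w')).[0])%:R : R) <=
       8 * 402 * (del + 2 * q^-1) by clear -del0 qi; lra.
    apply: (@le_trans _ _ (\avg_(u : V) \avg_(v : V) (8 * 402 * (b x u v + q^-1)))).
      apply: ler_avg => u; apply: ler_avg => v; have [h _ /(_ 0)[_ h2]] := plane x u v.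
      rewrite pl0 addr0 in h2.
      apply: (@le_trans _ _ (\avg_(w : W) \avg_(w' : W)
        (((B x (pl u v w)).[0] != h 0)%:R + ((B x (pl u v w')).[0] != h 0)%:R))).
        apply: ler_avg => w; apply: ler_avg => w'.
        by rewrite [(B x (pl u v w')).[0] == h 0]eq_sym; apply: indicator_neq.
      under eq_avg do rewrite avgD (avg_const _ 0).
      by rewrite avgD (avg_const _ 0); clear -h2; lra.
    under eq_avg do rewrite avgZ avgD (avg_const _ 0).
    by rewrite avgZ avgD (avg_const _ 0) ler_wpM2l //; have := hbx x; clear -qi; lra.
  rewrite /X avgC; have [u hu] := avg_ex_le (fun y : V => \avg_(u : V)
    (((B x u).[0] != (B x y).[0])%:R : R)) 0.
  by move=> hX'; exists (B x u).[0]; apply: le_trans hu hX'.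
have lines x u : exists2 p : {poly F}, (size p <= d.+1)%N &
    forall s, g' (x + s *: u) = p.[s].
  have avgw1 : \avg_(w : W) ((w 0 1 == 0)%:R : R) = q^-1.
    rewrite avg_row2 -[RHS](avg_const _ (0 : F)); apply: eq_avg => a.
    by under eq_avg do rewrite row2_1; rewrite avg_eq1.
  (* Here u is fixed and only v is random. If the second coordinate of w is non-zero, the plane is
     swept by parallel lines starting at the points x + s u, in a direction uniform in v. The error
     is thus an average of [err] over cones at these points, and the bound [err_x] at every point
     applies. *)
  have hb : \avg_(v : V) b x u v <= 1301 * del.
    rewrite /b avgC; under eq_avg do rewrite avgC.
    rewrite avgC.
    under eq_avg do rewrite avgC.
    apply: (@le_trans _ _ (\avg_(w : W) (1300 * del + (w 0 1 == 0)%:R))); last first.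
      by rewrite avgD (avg_const _ 0) avgw1; clear -del0 qi; lra.
    apply: ler_avg => w; have [_|w0] := eqVneq (w 0 1) 0.
      apply: (@le_trans _ _ 1); last by rewrite lerDr; clear -del0 qi; lra.
      apply: (avg_le 0) => v; apply: (avg_le 0) => y; rewrite lern1; exact: leq_b1.
    rewrite addr0.
    under eq_avg => v.
      rewrite (@avg_plane_lines _ w w0).
      under eq_avg => s.
        under eq_avg do rewrite pl_line cB addr0.
        rewrite -/(err (x + pl u v (row2 s 0)) (pl u v w)) {1}/pl row2_0 row2_1.
        rewrite scale0r addr0.
        over.
      over.
    rewrite avgC; apply: (avg_le 0) => s.
    have -> : w = row2 (w 0 0) (w 0 1) by apply: row2P; rewrite ?row2_0 ?row2_1.
    by rewrite avg_pl_transverse // row2_1.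
  have /choice[h hh] : forall v, exists h : W -> F, polyfun d h /\ forall y0 : W,
     \avg_(w : W) (((B (x + pl u v y0) (pl u v w)).[0] != h y0)%:R : R)
     <= 4 * 402 * (b x u v + q^-1).
    by move=> v; have [h ph hh] := plane x u v; exists h; split=> // y0; case: (hh y0).
  pose bad s v : R := (h v (row2 s 0) != g' (x + s *: u))%:R.
  have hbad s : \avg_(v : V) bad s v <= 1 / 10.
    have h1 : \avg_(v : V) \avg_(w : W)
       (((B (x + s *: u) (pl u v w)).[0] != g' (x + s *: u))%:R : R) <= (100 * 100 + 1) * del.
      rewrite avgC.
      apply: (@le_trans _ _ (\avg_(w : W) ((100 * 100) * del + (w 0 1 == 0)%:R))); last first.
        by rewrite avgD (avg_const _ 0) avgw1; clear -del0 qi; lra.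
      apply: ler_avg => w; have [_|w0] := eqVneq (w 0 1) 0.
        apply: (@le_trans _ _ 1); last by rewrite lerDr; clear -del0 qi; lra.
        by apply: (avg_le 0) => v; rewrite lern1; exact: leq_b1.
      rewrite addr0 (_ : w = row2 (w 0 0) (w 0 1)); last first.
        by apply: row2P; rewrite ?row2_0 ?row2_1.
      rewrite (avg_pl_transverse (fun y =>
         ((B (x + s *: u) y).[0] != g' (x + s *: u))%:R)) //.
    have h2 : \avg_(v : V) bad s v <= \avg_(v : V) (4 * 402 * (b x u v + q^-1) +
       \avg_(w : W) (((B (x + s *: u) (pl u v w)).[0] != g' (x + s *: u))%:R : R)).
      apply: ler_avg => v; have := (hh v).2 (row2 s 0).
      have -> : pl u v (row2 s 0) = s *: u.
        by rewrite /pl row2_0 row2_1 scale0r addr0.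
      move=> h3; apply: (@le_trans _ _ (\avg_(w : W)
        (((B (x + s *: u) (pl u v w)).[0] != h v (row2 s 0))%:R +
         ((B (x + s *: u) (pl u v w)).[0] != g' (x + s *: u))%:R))); last first.
        by rewrite avgD lerD2r.
      apply: (avg_ge 0) => w; rewrite /bad.
      by rewrite [(B _ _).[0] == h v _]eq_sym; apply: indicator_neq.
    move: h2; rewrite avgD avgZ avgD (avg_const _ 0); clear -h1 hb del0 hdel; lra.
  have bad01 s v : 0 <= bad s v <= 1 by exact: indicator_ge0.
  pose N v := \avg_(s : F) bad s v.
  have N0 v : 0 <= N v by apply: avg_ge0 => s; case/andP: (bad01 s v).
  have hN : avg N <= 1 / 10 by rewrite /N avgC; apply: (avg_le 0).
  have /choice[p hp] : forall v, exists p : {poly F}, (size p <= d.+1)%N /\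
      forall s, h v (row2 s 0) = p.[s].
    move=> v; have [p sp hp] := PolyFun.polyfun_line 0 (row2 1 0) (hh v).1.
    exists p; split => // s; rewrite -hp add0r; congr h.
    by apply: row2P; rewrite !mxE /= ?mulr1 ?mulr0.
  have [v0 hv0] := avg_ex_le N 0.
  exists (p v0) => [|s]; first by case: (hp v0).
  (* For each s a second plane v is taken, correct at s itself and on most of the line. It agrees
     with the fixed plane v0 at more than d parameters, so both induce the same polynomial on the
     line, and that one gives [g'] at s. *)
  have [v hv] := avg_ex_le (fun v => bad s v + 3 * N v) 0.
  have {}hv : bad s v + 3 * N v <= 4 / 10.
    by apply: (le_trans hv); rewrite avgD avgZ; have := hbad s; clear -hN; lra.
  have bs : bad s v = 0.
    by move: hv; have := N0 v; rewrite /bad; case: (_ == _) => //=; clear -del0; lra.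
  have -> : g' (x + s *: u) = (p v).[s].
    rewrite -(hp v).2; apply/esym/eqP; move: bs; rewrite /bad; case: eqP => //= _.
    by move/eqP; rewrite oner_eq0.
  congr (_.[s]); apply: (@poly_eq_avg R F _ _ d
    (fun s => (h v (row2 s 0) == g' (x + s *: u)) && (h v0 (row2 s 0) == g' (x + s *: u)))
    (hp v).1 (hp v0).1).
    apply: (@lt_le_trans _ _ (\avg_(s : F) (1 - bad s v - bad s v0))).
      rewrite !avgB (avg_const _ 0) -/(N v) -/(N v0).
      have : d%:R / q <= 1 / 1000.
        by rewrite ler_pdivrMr //; have := ler0n R d; clear -hq; lra.
      by move: hv hv0; rewrite bs; clear -hN; lra.
    by apply: ler_avg => s'; apply: indicator_and.
  by move=> s' /andP[/eqP e1 /eqP e2]; rewrite -(hp v).2 -(hp v0).2 e1 e2.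
exists g'.
  apply: PolyFun.polyfun_of_lines => //; rewrite -(ltr_nat R) natrM.
  have : (1 : R) <= d%:R by rewrite ler1n.
  by clear -hq; lra.
apply: (@le_trans _ _ (\avg_(x : V) \avg_(u : V)
   ((g x != (B x u).[0])%:R + ((B x u).[0] != g' x)%:R : R))).
  apply: ler_avg => x; apply: (avg_ge 0) => u.
  exact: indicator_neq.
under eq_avg do rewrite avgD.
rewrite avgD.
have : \avg_(x : V) \avg_(u : V) (((B x u).[0] != g' x)%:R : R) <= (100 * 100) * del.
  by apply: (avg_le 0) => x; exact: hg'.
clear -eta0 hdel del0 qi; lra.
Qed.

End TotalTest.

(** * From a partial function consistent on lines to a total one *)

Section PartialTest.
Variables (R : archiRealFieldType) (F : finFieldType) (m : nat).
Local Notation V := 'rV[F]_m.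
Local Notation W := 'rV[F]_2.
Local Notation q := (#|F|%:R : R).

(** The plane splits into the lines through x + b v in direction u. If D has density below al/4 on
    it, then at least half of these lines have density below al/2, and [line_sampling] bounds such
    lines. *)
Lemma plane_density (D : V -> bool) (al := \avg_(x : V) ((D x)%:R : R)) : 0 < al ->
  \avg_(x : V) \avg_(u : V) \avg_(v : V)
    ((\avg_(y : W) ((D (x + pl u v y))%:R : R) < al / 4)%R%:R : R) <= 8 / (al * q).
Proof.
move=> al0; pose dens x u := \avg_(t : F) ((D (x + t *: u))%:R : R).
apply: (@le_trans _ _ (\avg_(x : V) \avg_(u : V) \avg_(v : V)
   (2 * (\avg_(b : F) ((dens (x + b *: v) u < al / 2)%R%:R : R))))).
  apply: ler_avg => x; apply: ler_avg => u; apply: ler_avg => v.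
  set c := avg (fun b : F => _).
  have c0 : 0 <= c by apply: avg_ge0 => b; rewrite ler0n.
  case: ltP => [hlt|_] /=; last by rewrite mulr_ge0.
  have : al / 2 * (1 - c) <= \avg_(y : W) ((D (x + pl u v y))%:R : R).
    rewrite avg_row2 avgC.
    apply: (@le_trans _ _ (\avg_(b : F) (al / 2 * (1 - (dens (x + b *: v) u < al / 2)%R%:R)))).
      by rewrite avgZ avgB (avg_const _ 0).
    apply: ler_avg => b.
    have -> : \avg_(a : F) ((D (x + pl u v (row2 a b)))%:R : R) = dens (x + b *: v) u.
      apply: eq_avg => a; congr ((D _)%:R : R).
      by rewrite /pl row2_0 row2_1 [a *: u + _]addrC addrA.
    case: (ltP (dens _ _) _) => h /=; last by rewrite subr0 mulr1.
    by rewrite subrr mulr0; apply: avg_ge0 => a; rewrite ler0n.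
  by nra.
under eq_avg do under eq_avg do rewrite avgZ.
under eq_avg do rewrite avgZ.
rewrite avgZ.
have -> : \avg_(x : V) \avg_(u : V) \avg_(v : V) \avg_(b : F)
    ((dens (x + b *: v) u < al / 2)%R%:R : R) =
    \avg_(x : V) \avg_(u : V) ((dens x u < al / 2)%R%:R : R).
  rewrite [LHS]avgC [RHS]avgC; apply: eq_avg => u.
  rewrite avgC -[RHS](avg_const _ (0 : V)); apply: eq_avg => v.
  rewrite avgC -[RHS](avg_const _ (0 : F)); apply: eq_avg => b.
  exact: (avg_shift (fun x => (dens x u < al / 2)%R%:R)).
have := line_sampling (S := D) al0; rewrite -/al -/dens.
by set z := avg _ => hz; lra.
Qed.

(** On a plane dense in D with small error, [plane_robust] makes H coincide with one polynomial on
    most lines, so two lines through a point usually predict the same value there. Otherwise the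
    right-hand side exceeds 1. The constant is 2 * 400 * 4^2, for two lines and density al/4. *)
Lemma plane_consistency d (D : V -> bool) (f : V -> F) (H : V -> V -> {poly F}) (al : R)
    (x u v : V)
    (b := \avg_(y : W) \avg_(w : W)
      ((D (x + pl u v y) && (f (x + pl u v y) != (H (x + pl u v y) (pl u v w)).[0]))%:R : R)) :
  (0 < d)%N -> oracle d H -> 0 < al -> al <= 1 -> 10 ^+ 7 * d%:R <= al ^+ 3 * q ->
  \avg_(y : W) \avg_(w : W) \avg_(w' : W)
    (((H (x + pl u v y) (pl u v w)).[0] != (H (x + pl u v y) (pl u v w')).[0])%:R : R)
  <= (\avg_(y : W) ((D (x + pl u v y))%:R : R) < al / 4)%R%:R
     + 160 * 80 * (q^-1 + b) / al ^+ 2.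
Proof.
move=> d0 oH al0 al1 hq; have q0 := card_gt0 R F.
have qi : 0 < q^-1 by rewrite invr_gt0.
have b0 : 0 <= b by apply: avg_ge0 => y; apply: avg_ge0 => w; rewrite ler0n.
set X := avg _; set Y := 160 * 80 * _ / _.
have X1 : X <= 1.
  by do 3![apply: (avg_le 0) => ?]; rewrite lern1 leq_b1.
have Y0 : 0 <= Y.
  by apply: divr_ge0; [lra | rewrite exprn_ge0 // ltW].
case: ltP => [_|hD] /=; first by apply: (le_trans X1); rewrite lerDl.
rewrite add0r; have [hb|hb] := leP b (al / 4 / 2); last first.
  apply: (le_trans X1); rewrite /Y ler_pdivlMr ?exprn_gt0 // mul1r.
  have : al ^+ 2 <= al by rewrite expr2 ger_pMl.
  by lra.
have [|||||||h ph hh] := @plane_robust R F d (fun y => D (x + pl u v y))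
   (fun y => f (x + pl u v y)) (fun y w => H (x + pl u v y) (pl u v w)) (al / 4) b d0.
- by rewrite divr_gt0.
- by lra.
- have -> : (al / 4) ^+ 3 * q = al ^+ 3 * q / 64 by field.
  by have := ler0n R d; lra.
- exact: oracle_pl.
- exact: hD.
- exact: lexx.
- exact: hb.
have {}hh : 2 * (\avg_(y : W) \avg_(w : W) (([exists t,
     (H (x + pl u v y) (pl u v w)).[t] != h (y + t *: w)])%:R : R)) <= Y.
  apply: (@le_trans _ _ (2 * (400 * (q^-1 + b) / (al / 4) ^+ 2))); first by rewrite ler_pM2l.
  rewrite le_eqVlt; apply/orP; left; apply/eqP; rewrite /Y.
  by field; rewrite !gt_eqF.
apply: le_trans hh; apply: (@le_trans _ _ (\avg_(y : W) \avg_(w : W) \avg_(w' : W)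
   (([exists t, (H (x + pl u v y) (pl u v w)).[t] != h (y + t *: w)])%:R +
    ([exists t, (H (x + pl u v y) (pl u v w')).[t] != h (y + t *: w')])%:R : R))).
  apply: ler_avg => y; apply: ler_avg => w; apply: ler_avg => w'.
  apply: indicator_or; apply: contraR; rewrite negb_or => /andP[/existsPn h1 /existsPn h2].
  move: (h1 0) (h2 0); rewrite !negbK !scale0r !addr0 => /eqP -> /eqP ->.
  by rewrite eqxx.
under eq_avg do under eq_avg do rewrite avgD (avg_const _ 0).
under eq_avg do rewrite avgD (avg_const _ 0).
by rewrite avgD; set z := avg _; lra.
Qed.

Theorem partial_test d (D : V -> bool) (f : V -> F) (H : V -> V -> {poly F})
    (al := \avg_(x : V) ((D x)%:R : R))
    (b := \avg_(x : V) \avg_(u : V) ((D x && (f x != (H x u).[0]))%:R : R)) :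
  (0 < d)%N -> oracle d H -> 0 < al ->
  10 ^+ 7 * d%:R <= al ^+ 3 * q -> 10 ^+ 13 * (b + q^-1) <= al ^+ 2 ->
  exists2 Q : V -> F, polyfun d Q &
    al / 20 <= \avg_(x : V) ((D x && (f x == Q x))%:R : R).
Proof.
move=> d0 oH al0 hd hb; have q0 := card_gt0 R F; have [sH cH] := oH.
have qi : 0 < q^-1 by rewrite invr_gt0.
have b0 : 0 <= b by apply: avg_ge0 => x; apply: avg_ge0 => u; rewrite ler0n.
have al1 : al <= 1 by apply: (avg_le 0) => x; rewrite lern1 leq_b1.
have al2 : al ^+ 2 <= al by rewrite expr2 ger_pMl.
have al3 : al ^+ 3 <= 1 by rewrite exprn_ile1 // ltW.
have hdq : 10 ^+ 7 * d%:R <= q.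
  by apply: (le_trans hd); rewrite ger_pMl.
(* Disagreement between the values predicted in directions a and c, measured over all x and not only
   over x in D; this is what lets H define a total function. *)
pose G a c := \avg_(x : V) (((H x a).[0] != (H x c).[0])%:R : R).
have G01 a c : 0 <= G a c <= 1.
  apply/andP; split; first by apply: avg_ge0 => t; rewrite ler0n.
  by apply: (avg_le 0) => t; rewrite lern1 leq_b1.
pose B a := \avg_(x : V) ((D x && (f x != (H x a).[0]))%:R : R).
have B01 a : 0 <= B a <= 1.
  apply/andP; split; first by apply: avg_ge0 => t; rewrite ler0n.
  by apply: (avg_le 0) => t; rewrite lern1 leq_b1.
have swap (K : V -> V -> V -> W -> R) :
   \avg_(x : V) \avg_(u : V) \avg_(v : V) \avg_(y : W) K (x + pl u v y) u v y =
   \avg_(u : V) \avg_(v : V) \avg_(y : W) \avg_(x : V) K x u v y.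
  rewrite [LHS]avgC; apply: eq_avg => u; rewrite avgC; apply: eq_avg => v.
  by rewrite avgC; apply: eq_avg => y; rewrite (avg_shift (fun x => K x u v y)).
pose bp x u v := \avg_(y : W) \avg_(w : W)
  ((D (x + pl u v y) && (f (x + pl u v y) != (H (x + pl u v y) (pl u v w)).[0]))%:R : R).
have hbp : \avg_(x : V) \avg_(u : V) \avg_(v : V) bp x u v <= b + 2 / q.
  rewrite (swap (fun x u v _ => \avg_(w : W) ((D x && (f x != (H x (pl u v w)).[0]))%:R : R))).
  have := @avg_planes_le R F m (fun a _ => B a) (fun a _ => B01 a).
  have -> : \avg_(u : V) \avg_(v : V) \avg_(w : W) \avg_(w' : W) B (pl u v w) =
    \avg_(u : V) \avg_(v : V) \avg_(y : W) \avg_(x : V) \avg_(w : W)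
      ((D x && (f x != (H x (pl u v w)).[0]))%:R : R).
    apply: eq_avg => u; apply: eq_avg => v; rewrite avgC; apply: eq_avg => y.
    by rewrite avgC.
  under [X in _ <= X + _ -> _]eq_avg do rewrite (avg_const _ 0).
  by rewrite /B [X in _ <= X + _ -> _]avgC.
have hG : \avg_(u : V) \avg_(v : V) G u v <=
   8 / (al * q) + 160 * 80 * (q^-1 + (b + 2 / q)) / al ^+ 2 + 2 / q.
  apply: (le_trans (avg_planes_ge G01)); rewrite lerD2r.
  have -> : \avg_(u : V) \avg_(v : V) \avg_(w : W) \avg_(w' : W) G (pl u v w) (pl u v w') =
     \avg_(x : V) \avg_(u : V) \avg_(v : V) \avg_(y : W) \avg_(w : W) \avg_(w' : W)
      (((H (x + pl u v y) (pl u v w)).[0] != (H (x + pl u v y) (pl u v w')).[0])%:R : R).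
    rewrite (swap (fun x u v _ => \avg_(w : W) \avg_(w' : W)
      (((H x (pl u v w)).[0] != (H x (pl u v w')).[0])%:R : R))).
    apply: eq_avg => u; apply: eq_avg => v; rewrite (avg_const _ 0).
    by rewrite [RHS]avgC; apply: eq_avg => w; rewrite avgC.
  apply: (@le_trans _ _ (\avg_(x : V) \avg_(u : V) \avg_(v : V)
    ((\avg_(y : W) ((D (x + pl u v y))%:R : R) < al / 4)%R%:R
     + (160 * 80 / al ^+ 2 * q^-1 + 160 * 80 / al ^+ 2 * bp x u v)))).
    apply: ler_avg => x; apply: ler_avg => u; apply: ler_avg => v.
    apply: le_trans (plane_consistency D f x u v d0 oH al0 al1 hd) _.
    by rewrite lerD2l -/(bp x u v) -mulrDr mulrAC.
  under eq_avg do under eq_avg do rewrite 2!avgD (avg_const _ 0) avgZ.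
  under eq_avg do rewrite 2!avgD (avg_const _ 0) avgZ.
  rewrite 2!avgD (avg_const _ 0) avgZ.
  apply: lerD; first exact: plane_density.
  rewrite -mulrDr [leRHS]mulrAC ler_wpM2l ?lerD2l //.
  by apply: divr_ge0; [clear -qi; lra | rewrite exprn_ge0 // ltW].
have {}hG : \avg_(u : V) \avg_(v : V) G u v <= (200 * 200) * (b + q^-1) / al ^+ 2.
  apply: (le_trans hG); rewrite ler_pdivlMr ?exprn_gt0 //.
  have -> : (8 / (al * q) + 160 * 80 * (q^-1 + (b + 2 / q)) / al ^+ 2 + 2 / q) * al ^+ 2
    = 8 * (al * q^-1) + 160 * 80 * (q^-1 + (b + 2 / q)) + 2 * (al ^+ 2 * q^-1).
    by field; rewrite !gt_eqF.
  have : al * q^-1 <= q^-1 by rewrite ger_pMl.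
  have : al ^+ 2 * q^-1 <= q^-1 by rewrite ger_pMl // (le_trans al2).
  by clear -b0 qi; lra.
have hth : (200 * 200) * (b + q^-1) / al ^+ 2 <= (200 * 200) / 10 ^+ 13.
  rewrite ler_pdivrMr ?exprn_gt0 // -[leRHS]mulrA ler_pM2l ?mulr_gt0 //.
  by rewrite ler_pdivlMl ?exprn_gt0.
have hqi : 10 ^+ 13 * q^-1 <= 1.
  apply: (@le_trans _ _ (10 ^+ 13 * (b + q^-1))); last by apply: (le_trans hb); lra.
  by rewrite ler_pM2l ?exprn_gt0 // lerDr.
(* The total function: at x, the prediction in a direction that disagrees with the others no more
   than the average. *)
have /choice[g hg] : forall x, exists z : F, \avg_(u : V) ((z != (H x u).[0])%:R : R) <=
   \avg_(c : V) \avg_(u : V) (((H x c).[0] != (H x u).[0])%:R : R).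
  move=> x; have [c hc] := avg_ex_le (fun c : V =>
    \avg_(u : V) (((H x c).[0] != (H x u).[0])%:R : R)) 0.
  by exists (H x c).[0].
have {}hg : \avg_(x : V) \avg_(u : V) ((g x != (H x u).[0])%:R : R) <= (200 * 200) / 10 ^+ 13.
  apply: le_trans hth; apply: le_trans hG.
  apply: (@le_trans _ _ (\avg_(x : V) \avg_(c : V) \avg_(u : V)
    (((H x c).[0] != (H x u).[0])%:R : R))); first exact: ler_avg.
  by rewrite avgC; under eq_avg do rewrite avgC.
have [||Q pQ hQ] := @total_test R F m d g H d0 oH.
- by have := ler0n R d; lra.
- by clear -hg hqi; lra.
exists Q => //.
pose bad x u : R := ([exists t, (H x u).[t] != Q (x + t *: u)])%:R.
have hbad : \avg_(x : V) \avg_(u : V) bad x u <= 1 / 25.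
  apply: (@le_trans _ _ (\avg_(x : V) \avg_(u : V)
     (2 * (\avg_(t : F) (((H (x + t *: u) u).[0] != Q (x + t *: u))%:R : R))))).
    apply: ler_avg => x; apply: ler_avg => u; set e := avg _.
    have e0 : 0 <= e by apply: avg_ge0 => t; rewrite ler0n.
    rewrite /bad; case: existsP => [[t0 ht0]|_] /=; last by rewrite mulr_ge0.
    rewrite leNgt; apply/negP => hlt; case/negP: ht0.
    have [p sp hp] := PolyFun.polyfun_line x u pQ; rewrite hp; apply/eqP; congr (_.[t0]).
    apply: (@poly_eq_avg R F _ _ d (fun t => (H x u).[t] == Q (x + t *: u)) (sH _ _) sp).
      apply: (@lt_le_trans _ _ (\avg_(t : F) (1 - ((H (x + t *: u) u).[0] != Q (x + t *: u))%:R))).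
        rewrite avgB (avg_const _ 0) -/e.
        have : d%:R / q <= 1 / 1000.
          by rewrite ler_pdivrMr //; have := ler0n R d; clear -hdq; lra.
        by clear -hlt; lra.
      apply: ler_avg => t; rewrite cH addr0.
      by case: (_ == _); rewrite /= ?subr0 ?subrr.
    by move=> t /eqP ->; rewrite hp.
  under eq_avg do rewrite avgZ.
  rewrite avgZ (avg_line_shift (fun x u => ((H x u).[0] != Q x)%:R)).
  suff : \avg_(x : V) \avg_(u : V) (((H x u).[0] != Q x)%:R : R)
      <= (200 * 200) / 10 ^+ 13 + 1 / 100.
    by clear -qi; lra.
  apply: (@le_trans _ _ (\avg_(x : V) \avg_(u : V)
     ((g x != (H x u).[0])%:R + (g x != Q x)%:R))).
    apply: ler_avg => x; apply: ler_avg => u; rewrite [g x == _.[0]]eq_sym.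
    exact: indicator_neq.
  under eq_avg do rewrite avgD (avg_const _ 0).
  by rewrite avgD lerD.
pose dens x u := \avg_(t : F) ((D (x + t *: u))%:R : R).
pose err x u := \avg_(t : F)
  ((D (x + t *: u) && (f (x + t *: u) != (H (x + t *: u) u).[0]))%:R : R).
(* On a line where H is Q and D has density at least al/2, f can differ from Q on D only where it
   differs from H. *)
have key x u : al / 2 * (1 - (dens x u < al / 2)%R%:R - bad x u) - err x u <=
   \avg_(t : F) ((D (x + t *: u) && (f (x + t *: u) == Q (x + t *: u)))%:R : R).
  have err0 : 0 <= err x u by apply: avg_ge0 => t; rewrite ler0n.
  have out c : c <= 0 -> al / 2 * c - err x u <=
   \avg_(t : F) ((D (x + t *: u) && (f (x + t *: u) == Q (x + t *: u)))%:R : R).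
    move=> c0; apply: (@le_trans _ _ 0); last by apply: avg_ge0 => t; rewrite ler0n.
    by have : al / 2 * c <= 0; [rewrite mulr_ge0_le0 // divr_ge0 // ltW | lra].
  have bad0 : 0 <= bad x u by rewrite ler0n.
  case: (ltP (dens x u) (al / 2)) => hdens /=; first by apply: out; rewrite subrr sub0r oppr_le0.
  rewrite subr0; move: out; rewrite /bad; case: existsP => [_ out|ne _] /=.
    by apply: out; rewrite subrr.
  rewrite subr0 mulr1; apply: (@le_trans _ _ (dens x u - err x u)); first by rewrite lerD2r.
  rewrite -avgB; apply: ler_avg => t.
  have -> : (H (x + t *: u) u).[0] = Q (x + t *: u).
    by rewrite cH addr0; apply/eqP; apply: contraPT isT => ht; case: ne; exists t.
  by case: (D _); case: (_ == _); rewrite /= ?subr0 ?subrr.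
have := @line_sampling R F m D al0; rewrite -/al -/dens => hsam.
have -> : \avg_(x : V) ((D x && (f x == Q x))%:R : R) =
    \avg_(x : V) \avg_(u : V) \avg_(t : F)
      ((D (x + t *: u) && (f (x + t *: u) == Q (x + t *: u)))%:R : R).
  rewrite (avg_line_shift (fun x _ => (D x && (f x == Q x))%:R)).
  by apply: eq_avg => x; rewrite (avg_const _ 0).
apply: (@le_trans _ _ (\avg_(x : V) \avg_(u : V)
  (al / 2 * (1 - (dens x u < al / 2)%R%:R - bad x u) - err x u))); last first.
  by apply: ler_avg => x; apply: ler_avg => u; exact: key.
under eq_avg do rewrite avgB avgZ !avgB (avg_const _ 0).
rewrite avgB avgZ !avgB (avg_const _ 0).
rewrite (avg_line_shift (fun x u => (D x && (f x != (H x u).[0]))%:R)) -/b.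
have hb1 : b <= al / 100.
  have : 10 ^+ 13 * b <= 10 ^+ 13 * (b + q^-1) by rewrite ler_pM2l ?exprn_gt0 // lerDl ltW.
  by clear -hb al2 al0; lra.
have hs1 : 4 / (al * q) <= 1 / 100.
  rewrite (ler_pdivrMr _ _ (mulr_gt0 al0 q0)).
  have : 10 ^+ 13 * q^-1 <= al.
    apply: le_trans al2; apply: le_trans hb; rewrite ler_pM2l ?exprn_gt0 // lerDr //.
  rewrite ler_pdivrMr // => h; clear -h; lra.
move: hsam hbad; set z1 := avg _; set z2 := avg _ => hsam hbad.
have : al / 2 * (1 - 1 / 100 - 1 / 25) <= al / 2 * (1 - z1 - z2).
  by rewrite (ler_pM2l (divr_gt0 al0 (ltr0n R 2))); clear -hsam hbad hs1; lra.
by clear -hb1 al0; lra.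
Qed.

End PartialTest.

(** * List decoding in a plane *)

Section PlaneLists.
Variables (R : archiRealFieldType) (F : finFieldType).
Local Notation W := 'rV[F]_2.
Local Notation q := (#|F|%:R : R).

Lemma avg_sum (T : finType) (I : Type) (r : seq I) (P : pred I) (G : I -> T -> R) :
  \avg_(x : T) \sum_(i <- r | P i) G i x = \sum_(i <- r | P i) \avg_(x : T) G i x.
Proof. by rewrite /avg exchange_big /= mulr_suml. Qed.

Definition close_polys (d : nat) (f : W -> F) (eps : R) : {set {ffun W -> F}} :=
  [set k : {ffun W -> F} | `[< polyfun d k >] &&
     (eps ^+ 2 <= \avg_(y : W) ((f y == k y)%:R : R))].

Lemma close_polys_agree (d : nat) (f : W -> F) (eps : R) (k k' : {ffun W -> F}) :
  (0 < d)%N -> k \in close_polys d f eps -> k' \in close_polys d f eps -> k != k' ->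
  \avg_(y : W) ((k y == k' y)%:R : R) <= 2 * d%:R / q.
Proof.
move=> d0; rewrite !inE => /andP[/asboolP pk _] /andP[/asboolP pk' _] kk'.
have [z hz] : exists z, k z != k' z.
  apply: contrapT => h; case/negP: kk'; apply/eqP/ffunP => z.
  by apply/eqP; apply: contraPT isT => hz; case: h; exists z.
exact: polyfun_agree hz.
Qed.

Lemma card_close_polys (d : nat) (f : W -> F) (eps : R) :
  (0 < d)%N -> 0 < eps -> eps <= 1 -> 72 * d%:R <= eps ^+ 5 * q ->
  #|close_polys d f eps|%:R <= 3 / eps ^+ 2.
Proof.
move=> d0 e0 e1 hd; have q0 := card_gt0 R F; set L := close_polys d f eps.
have e2 : 0 < eps ^+ 2 by rewrite exprn_gt0.
have e21 : eps ^+ 2 <= 1 by rewrite exprn_ile1 // ltW.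
rewrite leNgt; apply/negP => hL.
pose N := (Num.truncn (2 / eps ^+ 2)).+1.
have ei : 1 <= (eps ^+ 2)^-1 by rewrite invf_ge1.
have /andP[N1 N2] : (N.-1%:R <= 2 / eps ^+ 2) && (2 / eps ^+ 2 < N%:R).
  by apply: truncn_itv; rewrite divr_ge0 // ltW.
have N3 : (N%:R : R) <= 3 / eps ^+ 2.
  by rewrite -[N]/(N.-1.+1) -natr1; clear -N1 ei; lra.
have NL : (N <= #|L|)%N by rewrite -(ler_nat R) (le_trans N3) // ltW.
have [s us [ss sL]] : exists2 s, uniq s & size s = N /\ {subset s <= L}.
  by have [s [? ? ?]] := elimT card_geqP NL; exists s.
(* If n members of the list equal f at y, then (n - 1)(n - 2) >= 0 gives 3n <= n^2 + 2. Averaging,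
   with rare coincidences of distinct members, bounds the sum of the agreements by 3/2, whereas N
   was chosen to make it exceed 2. *)
have pt y : 3 * (\sum_(k <- s) (f y == k y)%:R) <=
   \sum_(k <- s) \sum_(k' <- s) ((f y == k y) && (f y == k' y))%:R + 2 :> R.
  have -> : \sum_(k <- s) \sum_(k' <- s) ((f y == k y) && (f y == k' y))%:R =
     (\sum_(k <- s) (f y == k y)%:R) ^+ 2 :> R.
    rewrite expr2 big_distrlr /=; apply: eq_bigr => k _; apply: eq_bigr => k' _.
    by rewrite -natrM mulnb.
  rewrite -natr_sum; case: (\sum_(k <- s) _)%N => [|[|[|n]]].
  - by rewrite mulr0 expr0n /=; lra.
  - by rewrite mulr1 expr1n; lra.
  - by lra.
  - by rewrite -[n.+3]addn3 natrD; have := ler0n R n; nra.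
have avgpt : \avg_(y : W) (3 * (\sum_(k <- s) (f y == k y)%:R : R)) <= \avg_(y : W)
   (\sum_(k <- s) \sum_(k' <- s) ((f y == k y) && (f y == k' y))%:R + 2).
  by apply: ler_avg.
rewrite avgZ avgD (avg_const _ 0) !avg_sum in avgpt.
pose A (k : {ffun W -> F}) := \avg_(y : W) ((f y == k y)%:R : R).
have A1 : N%:R * eps ^+ 2 <= \sum_(k <- s) A k.
  rewrite -ss -sum1_size natr_sum mulr_suml big_seq [leRHS]big_seq.
  by apply: ler_sum => k /sL; rewrite mul1r inE => /andP[].
have A2 : \sum_(k <- s) \avg_(y : W) \sum_(k' <- s) (((f y == k y) && (f y == k' y))%:R : R)
   <= \sum_(k <- s) A k + N%:R * (N%:R * (2 * d%:R / q)).
  have -> : N%:R * (N%:R * (2 * d%:R / q)) = \sum_(k <- s) (N%:R * (2 * d%:R / q)) :> R.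
    by rewrite big_const_seq count_predT ss iter_addr_0 -[RHS]mulr_natl.
  rewrite -big_split /= big_seq [leRHS]big_seq; apply: ler_sum => k ks.
  rewrite avg_sum (bigD1_seq k) //=; apply: lerD.
    by apply: ler_avg => y; rewrite andbb.
  apply: (@le_trans _ _ (\sum_(k' <- s) (2 * d%:R / q))); last first.
    by rewrite big_const_seq count_predT ss iter_addr_0 -[leLHS]mulr_natl.
  rewrite big_mkcond /= big_seq [leRHS]big_seq; apply: ler_sum => k' k's.
  case: eqP => /= [_|/eqP kk']; first by rewrite divr_ge0 // mulr_ge0.
  apply: le_trans (close_polys_agree d0 (sL _ ks) (sL _ k's) _); last by rewrite eq_sym.
  by apply: ler_avg => y; rewrite ler_nat; case: eqP => // <-; case: eqP.
have A3 : 2 < N%:R * eps ^+ 2 by rewrite -ltr_pdivrMr.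
have A4 : N%:R * (N%:R * (2 * d%:R / q)) <= 1 :> R.
  apply: (@le_trans _ _ (3 / eps ^+ 2 * (3 / eps ^+ 2 * (2 * d%:R / q)))).
    have c0 : 0 <= 2 * d%:R / q :> R by rewrite divr_ge0 // mulr_ge0.
    apply: ler_pM => //; first by rewrite mulr_ge0.
    by rewrite ler_wpM2r.
  have -> : 3 / eps ^+ 2 * (3 / eps ^+ 2 * (2 * d%:R / q)) = 18 * d%:R / (eps ^+ 4 * q).
    by field; rewrite !gt_eqF.
  rewrite ler_pdivrMr ?mulr_gt0 ?exprn_gt0 // mul1r.
  have : eps ^+ 5 * q <= eps ^+ 4 * q.
    by rewrite ler_pM2r // exprS ger_pMl // exprn_gt0.
  by have := ler0n R d; clear -hd; lra.
by move: avgpt; rewrite -/(A _); clear -A1 A2 A3 A4; lra.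
Qed.

(** If the agreeing lines matching no list member had density above 5 eps, [plane_test] would give a
    close polynomial equal to the oracle on one of them, a contradiction. Among list members, the
    value f(x) singles out one unless two collide at x; collisions account for the sixth eps and for
    the power eps^5. *)
Lemma plane_lists (d : nat) (f : W -> F) (P : W -> W -> {poly F}) (eps : R) :
  (0 < d)%N -> 0 < eps -> eps <= 1 -> 72 * d%:R <= eps ^+ 5 * q -> oracle d P ->
  exists h : W -> W -> F, (forall x, polyfun d (h x)) /\
    \avg_(x : W) \avg_(u : W) (((f x == (P x u).[0]) &&
       [exists t, (P x u).[t] != h x (x + t *: u)])%:R : R) <= 6 * eps.
Proof.
move=> d0 e0 e1 hd oP; have q0 := card_gt0 R F.
have cL := @card_close_polys d f eps d0 e0 e1 hd.
set L := close_polys d f eps in cL.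
have hd3 : 72 * d%:R <= eps ^+ 3 * q.
  apply: (le_trans hd); rewrite ler_pM2r // (exprD eps 3 2) ger_pMr ?exprn_gt0 //.
  by rewrite exprn_ile1 // ltW.
pose E x u := (f x == (P x u).[0]) &&
   [forall k in L, [exists t, (P x u).[t] != k (x + t *: u)]].
have hE : \avg_(x : W) \avg_(u : W) ((E x u)%:R : R) <= 5 * eps.
  rewrite leNgt; apply/negP => hE.
  have [|k [pk [x [u [Exu hk]]] hag]] :=
    @PlaneTest.plane_test R F d f P E eps d0 e0 e1 hd3 oP _ (ltW hE).
    by move=> x u /andP[/eqP].
  have kL : finfun k \in L.
    rewrite inE; apply/andP; split.
      by apply/asboolP; apply: PolyFun.eq_polyfun pk => y; rewrite ffunE.
    apply: (le_trans hag); apply: ler_avg => y; rewrite ffunE ler_nat.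
    by case: [exists u, _].
  have /andP[_ /forall_inP/(_ _ kL)/existsP[t]] := Exu.
  by rewrite ffunE hk eqxx.
pose h x : W -> F := if [pick k in L | k x == f x] is Some k then k else fun=> 0.
exists h; split.
  move=> x; rewrite /h; case: pickP => [k /andP[]|_]; last exact: PolyFun.polyfun_const.
  by rewrite inE => /andP[/asboolP].
pose col x := \sum_(k in L) \sum_(k' in L | k' != k) ((k x == k' x)%:R : R).
have hcol : \avg_(x : W) col x <= eps.
  rewrite /col avg_sum.
  apply: (@le_trans _ _ (\sum_(k in L) \sum_(k' in L) (2 * d%:R / q))).
    apply: ler_sum => k kL; rewrite avg_sum.
    rewrite big_mkcondr; apply: ler_sum => k' k'L.
    case: eqP => /= [_|/eqP kk']; first by rewrite divr_ge0 // mulr_ge0.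
    by apply: (close_polys_agree d0 kL k'L); rewrite eq_sym.
  rewrite !sumr_const -[X in X *+ _ <= _]mulr_natl -[X in X <= _]mulr_natl.
  apply: (@le_trans _ _ (3 / eps ^+ 2 * (3 / eps ^+ 2 * (2 * d%:R / q)))).
    have c0 : 0 <= 2 * d%:R / q :> R by rewrite divr_ge0 // mulr_ge0.
    apply: ler_pM => //; first by rewrite mulr_ge0.
    by rewrite ler_wpM2r.
  have -> : 3 / eps ^+ 2 * (3 / eps ^+ 2 * (2 * d%:R / q)) = 18 * d%:R / (eps ^+ 4 * q).
    by field; rewrite !gt_eqF.
  rewrite ler_pdivrMr ?mulr_gt0 ?exprn_gt0 // mulrA -exprS.
  by have := ler0n R d; clear -hd; lra.
apply: (@le_trans _ _ (\avg_(x : W) \avg_(u : W) ((E x u)%:R + col x))); last first.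
  under eq_avg do rewrite avgD (avg_const _ 0).
  by rewrite avgD; clear -hE hcol; lra.
apply: ler_avg => x; apply: ler_avg => u.
have col0 : 0 <= col x by apply: sumr_ge0 => k _; apply: sumr_ge0 => k' _.
case: andP => [[fx /existsP[t0 ht0]]|_]; last by rewrite addr_ge0.
rewrite /E fx /=; case: forall_inP => [_|nE]; first by rewrite lerDl.
rewrite add0r.
have [k kL hk] : exists2 k, k \in L & forall t, (P x u).[t] = k (x + t *: u).
  apply: contrapT => hn; apply: nE => k kL; apply: contraPT isT => /existsPn hk.
  by case: hn; exists k => // t; apply/eqP; rewrite -[_ == _]negbK.
have kx : k x = f x by rewrite (eqP fx) hk scale0r addr0.
move: ht0; rewrite /h; case: pickP => [k' /andP[k'L /eqP k'x] ht0|/(_ k)]; last first.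
  by rewrite kL kx eqxx.
have kk' : k' != k by apply: contraNneq ht0 => ->; rewrite hk.
rewrite /col (bigD1 k) //= (bigD1 k') /= ?k'L ?kk' // kx k'x eqxx -addrA lerDl.
by apply: addr_ge0; apply: sumr_ge0 => ? _ //; apply: sumr_ge0.
Qed.

End PlaneLists.

(** * Pairs of agreeing points on a line and the cone at a good base point *)

Section LineTest.
Variables (R : archiRealFieldType) (F : finFieldType) (m : nat).
Local Notation V := 'rV[F]_m.
Local Notation W := 'rV[F]_2.
Local Notation q := (#|F|%:R : R).

(** Cauchy-Schwarz over lines: the square counts pairs of agreeing points on a line. Coinciding
    pairs have weight 1/q, and the others are translated so that the first point is the base
    point. *)
Lemma agreement_pairs d (f : V -> F) (P : V -> V -> {poly F}) (K : R) : oracle d P ->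
  0 <= K ->
  (forall s : F, s != 0 -> \avg_(x : V) \avg_(u : V)
     (((f x == (P x u).[0]) && (f (x + s *: u) == (P x u).[s]))%:R : R) <= K) ->
  (\avg_(x : V) \avg_(u : V) ((f x == (P x u).[0])%:R : R)) ^+ 2 <= K + q^-1.
Proof.
move=> [_ cP] K0 hK.
rewrite -(avg_line_shift (fun x u => (f x == (P x u).[0])%:R)).
apply: (le_trans (avg_sqr _ (0 : V))).
apply: (@le_trans _ _ (\avg_(x : V) \avg_(u : V) (\avg_(t : F)
   ((f (x + t *: u) == (P x u).[t])%:R : R)) ^+ 2)).
  apply: ler_avg => x; apply: le_trans (avg_sqr _ (0 : V)) _; apply: ler_avg => u.
  by rewrite (eq_avg (g := fun t : F => ((f (x + t *: u) == (P x u).[t])%:R : R))) // => t;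
    rewrite cP addr0.
rewrite (_ : avg _ = \avg_(t : F) \avg_(t' : F) \avg_(x : V) \avg_(u : V)
   (((f (x + t *: u) == (P x u).[t]) && (f (x + t' *: u) == (P x u).[t']))%:R : R));
  last first.
  have swap (H : V -> V -> F -> F -> R) :
    \avg_(t : F) \avg_(t' : F) \avg_(x : V) \avg_(u : V) H x u t t' =
    \avg_(x : V) \avg_(u : V) \avg_(t : F) \avg_(t' : F) H x u t t'.
    under eq_avg do rewrite avgC.
    rewrite avgC; apply: eq_avg => x.
    under eq_avg do rewrite avgC.
    by rewrite avgC.
  rewrite swap; apply: eq_avg => x; apply: eq_avg => u; rewrite expr2 avgM.
  by apply: eq_avg => t; apply: eq_avg => t'; rewrite -natrM mulnb.
apply: (@le_trans _ _ (\avg_(t : F) \avg_(t' : F) (K + (t' == t)%:R))); last first.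
  rewrite -[leRHS](avg_const _ (0 : F)); apply: ler_avg => t.
  by rewrite avgD (avg_const _ (0 : F)) avg_eq1.
apply: ler_avg => t; apply: ler_avg => t'; have [_|tt'] := eqVneq t' t.
  apply: (@le_trans _ _ 1); last by rewrite lerDr.
  by do 2![apply: (avg_le 0) => ?]; rewrite lern1 leq_b1.
rewrite addr0; apply: le_trans (hK (t' - t) _); last by rewrite subr_eq0.
rewrite avgC [leRHS]avgC; apply: ler_avg => u.
rewrite -[leRHS](avg_shift _ (t *: u)); apply: ler_avg => x.
by rewrite !cP addr0 -addrA -scalerDl subrKC.
Qed.

(** For d = 0 the hypothesis on d/q says nothing about q. Oracle lines are constant, so two agreeing
    points have equal f-values. Either random pairs have equal values with probability at least
    eps^2, or 1/q >= 24 eps^2 and the most frequent value of f suffices. *)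
Lemma constant_test (f : V -> F) (P : V -> V -> {poly F}) (eps : R) : oracle 0 P ->
  0 < eps -> 5 * eps <= \avg_(x : V) \avg_(u : V) ((f x == (P x u).[0])%:R : R) ->
  exists2 Q : V -> F, polyfun 0 Q & eps ^+ 2 <= \avg_(x : V) ((f x == Q x)%:R : R).
Proof.
move=> oP e0 hag; have [sP cP] := oP.
pose K := \avg_(x : V) \avg_(y : V) ((f y == f x)%:R : R).
have K0 : 0 <= K by apply: avg_ge0 => x; apply: avg_ge0 => y; rewrite ler0n.
have hK : (\avg_(x : V) \avg_(u : V) ((f x == (P x u).[0])%:R : R)) ^+ 2 <= K + q^-1.
  apply: (agreement_pairs oP K0) => s s0.
  rewrite /K -(@avg_two_points R F m (fun x y => (f y == f x)%:R) 0 s) 1?eq_sym //.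
  apply: ler_avg => x; apply: ler_avg => u; rewrite scale0r addr0 ler_nat.
  case: andP => // -[/eqP -> /eqP ->].
  by rewrite (size1_polyC (sP x u)) !hornerC eqxx.
have h25 : 25 * eps ^+ 2 <= K + q^-1.
  apply: le_trans hK; rewrite (_ : 25 * eps ^+ 2 = (5 * eps) ^+ 2); last by ring.
  by rewrite ler_pXn2r // nnegrE; [rewrite mulr_ge0 // ltW |
    apply: le_trans hag; rewrite mulr_ge0 // ltW].
have e2 : 0 < eps ^+ 2 by rewrite exprn_gt0.
have [hh|hh] := leP (eps ^+ 2) K.
  have [y hy] := avg_ex_ge (fun x : V => \avg_(y : V) ((f y == f x)%:R : R)) 0.
  exists (fun=> f y); first exact: PolyFun.polyfun_const.
  exact: le_trans hh hy.
have [c hc] := avg_ex_ge (fun c : F => \avg_(x : V) ((f x == c)%:R : R)) 0.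
exists (fun=> c); first exact: PolyFun.polyfun_const.
apply: le_trans hc; rewrite avgC.
under eq_avg do under eq_avg do rewrite eq_sym.
under eq_avg do rewrite avg_eq1.
by rewrite (avg_const _ 0); clear -h25 hh e2; lra.
Qed.

(* At a base point x, the oracle's polynomials along the lines through x that
   agree with f at x define a partial function on V, which the plane lists show to
   be consistent with bivariate polynomials on most planes through x. *)
Lemma cone_at_good_point d (f : V -> F) (P : V -> V -> {poly F}) (e eps : R) :
  (0 < d)%N -> oracle d P ->
  (forall x u c t, c != 0 -> (P x (c *: u)).[t] = (P x u).[c * t]) ->
  0 < e -> e <= 1 -> 72 * d%:R <= e ^+ 5 * q ->
  0 < eps -> q^-1 <= eps ^+ 2 ->
  5 * eps <= \avg_(x : V) \avg_(u : V) ((f x == (P x u).[0])%:R : R) ->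
  exists (D : V -> bool) (H : V -> V -> {poly F}), [/\ oracle d H,
    21 * eps ^+ 2 <= \avg_(x : V) ((D x)%:R : R) &
    \avg_(x : V) \avg_(u : V) ((D x && (f x != (H x u).[0]))%:R : R)
      <= 2 * e / eps ^+ 2 + 2 / q].
Proof.
move=> d0 oP scP e0 e1 hd ep0 hqe hag; have q0 := card_gt0 R F; have [sP cP] := oP.
have ep2 : 0 < eps ^+ 2 by rewrite exprn_gt0.
(* The oracle's line through x and x + z agrees with f at both points. *)
pose Gam x z := (f x == (P x z).[0]) && (f (x + z) == (P x z).[1]).
pose gam x := \avg_(z : V) ((Gam x z)%:R : R).
have gam0 : 0 <= avg gam by apply: avg_ge0 => x; apply: avg_ge0 => z; rewrite ler0n.
have hgam : 24 * eps ^+ 2 <= avg gam.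
  have h1 : (\avg_(x : V) \avg_(u : V) ((f x == (P x u).[0])%:R : R)) ^+ 2 <= avg gam + q^-1.
    apply: (agreement_pairs oP gam0) => s s0; apply: ler_avg => x.
    rewrite /gam -[leRHS](avg_scale _ s0); apply: ler_avg => u.
    by rewrite /Gam !scP // mulr0 mulr1.
  have h2 : 25 * eps ^+ 2 <= avg gam + q^-1.
    apply: le_trans h1; rewrite (_ : 25 * eps ^+ 2 = (5 * eps) ^+ 2); last by ring.
    by rewrite ler_pXn2r // nnegrE; [rewrite mulr_ge0 // ltW |
      apply: le_trans hag; rewrite mulr_ge0 // ltW].
  by clear -h2 hqe; lra.
have /choice[h hh] : forall a : V * (V * V), exists h : W -> W -> F,
    (forall y, polyfun d (h y)) /\
    \avg_(y : W) \avg_(w : W) (((f (a.1 + pl a.2.1 a.2.2 y) ==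
        (P (a.1 + pl a.2.1 a.2.2 y) (pl a.2.1 a.2.2 w)).[0]) &&
       [exists t, (P (a.1 + pl a.2.1 a.2.2 y) (pl a.2.1 a.2.2 w)).[t]
          != h y (y + t *: w)])%:R : R) <= 6 * e.
  move=> [a [u v]] /=.
  exact: (plane_lists (fun y => f (a + pl u v y)) d0 e0 e1 hd (oracle_pl a u v oP)).
(* The plane has origin x - pl u v y, so that x has coordinate y in it: the lists belong to the
   plane, and x is a random point of that plane. *)
pose bad x u v y w : R := ((f x == (P x (pl u v w)).[0]) &&
  [exists t, (P x (pl u v w)).[t] != h (x - pl u v y, (u, v)) y (y + t *: w)])%:R.
pose b x := \avg_(u : V) \avg_(v : V) \avg_(y : W) \avg_(w : W) bad x u v y w.
have hb : avg b <= 6 * e.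
  apply: (@le_trans _ _ (\avg_(u : V) \avg_(v : V) \avg_(a : V) \avg_(y : W) \avg_(w : W)
     bad (a + pl u v y) u v y w)); last first.
    apply: (avg_le 0) => u; apply: (avg_le 0) => v; apply: (avg_le 0) => a.
    apply: le_trans (hh (a, (u, v))).2; rewrite /=.
    by apply: ler_avg => y; apply: ler_avg => w; rewrite /bad addrK.
  rewrite le_eqVlt; apply/orP; left; apply/eqP.
  rewrite /b avgC; apply: eq_avg => u; rewrite avgC; apply: eq_avg => v.
  rewrite avgC [RHS]avgC; apply: eq_avg => y.
  by rewrite (avg_shift (fun x => \avg_(w : W) bad x u v y w)).
(* This weight makes M * 6e = 3 eps^2, so that one base point has both [gam x] at least 21 eps^2 and
   [b x] at most 1/M = 2e/eps^2. *)
pose M := eps ^+ 2 / (2 * e).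
have M0 : 0 < M by rewrite divr_gt0 // mulr_gt0.
have [x hx] := avg_ex_ge (fun x => gam x - M * b x) 0.
have {}hx : 21 * eps ^+ 2 <= gam x - M * b x.
  apply: le_trans hx; rewrite avgB avgZ.
  have : M * avg b <= M * (6 * e) by rewrite ler_pM2l.
  have -> : M * (6 * e) = 3 * eps ^+ 2 by rewrite /M; field; rewrite gt_eqF.
  by clear -hgam; lra.
have bx0 : 0 <= b x.
  apply: avg_ge0 => u; apply: avg_ge0 => v; apply: avg_ge0 => y; apply: avg_ge0 => w.
  by rewrite ler0n.
have gx1 : gam x <= 1 by apply: (avg_le 0) => z; rewrite lern1 leq_b1.
have gx : 21 * eps ^+ 2 <= gam x.
  by have := mulr_ge0 (ltW M0) bx0; clear -hx; lra.
have bx : b x <= 2 * e / eps ^+ 2.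
  have : M * b x <= 1 by clear -hx gx1 ep2; lra.
  by rewrite -ler_pdivlMl // mulr1 /M invf_div.
pose D y := Gam x (y - x).
have [H oH bH] := best_fit R (fun y z => D y && (f y != z)) d.
exists D, H; split=> //.
  have -> // : \avg_(y : V) ((D y)%:R : R) = gam x.
  by rewrite -(avg_shift _ x); apply: eq_avg => y; rewrite /D addrK.
pose bf y u := \avg_(t : F) ((D (y + t *: u) && (f (y + t *: u) != (H y u).[t]))%:R : R).
have bf01 y u : 0 <= bf y u <= 1.
  apply/andP; split; first by apply: avg_ge0 => t; rewrite ler0n.
  by apply: (avg_le 0) => t; rewrite lern1 leq_b1.
rewrite -(avg_line_shift (fun y u => (D y && (f y != (H y u).[0]))%:R)).
have -> : \avg_(y : V) \avg_(u : V) \avg_(t : F) ((D (y + t *: u) &&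
     (f (y + t *: u) != (H (y + t *: u) u).[0]))%:R : R) =
   \avg_(a : V) \avg_(u : V) bf (x + a) u.
  transitivity (\avg_(y : V) \avg_(u : V) bf y u); last first.
    by symmetry; exact: (avg_shiftl (fun y => \avg_(u : V) bf y u) x).
  by apply: eq_avg => y; apply: eq_avg => u; apply: eq_avg => t; rewrite oH.2 addr0.
apply: (le_trans (avg_planes_ge (fun a u => bf01 (x + a) u))); rewrite lerD2r.
apply: le_trans bx; apply: ler_avg => u; apply: ler_avg => v.
pose k y := h (x - pl u v y, (u, v)) y.
pose X y w : R := (D (x + pl u v w) && (f (x + pl u v w) != k y (y + w)))%:R.
apply: (@le_trans _ _ (\avg_(y : W) \avg_(w : W) X y w)); last first.
  apply: ler_avg => y; apply: ler_avg => w; rewrite /X /bad ler_nat.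
  have -> : D (x + pl u v w) = Gam x (pl u v w) by rewrite /D addrAC subrr add0r.
  case: andP => // -[/andP[-> /eqP e3] ne] /=.
  rewrite (_ : [exists t, _]) //; apply/existsP; exists 1.
  by rewrite scale1r -e3.
rewrite -[leLHS](avg_const _ (0 : W)); apply: ler_avg => y.
have -> : \avg_(w : W) X y w = \avg_(w : W) \avg_(w' : W) \avg_(t : F) X y (w + t *: w').
  rewrite (avg_line_shift (fun w _ => X y w)); apply: eq_avg => w.
  by rewrite (avg_const _ 0).
apply: ler_avg => w; apply: ler_avg => w'.
(* The plane polynomial selected at x restricts to a competitor of the best fit on each line of the
   plane, so H does no worse. *)
have [p sp hp] := PolyFun.polyfun_line (y + w) w' ((hh (x - pl u v y, (u, v))).1 y).
apply: le_trans (bH _ _ p sp) _; apply: ler_avg => t.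
by rewrite /X /k pl_line [y + (w + _)]addrA hp.
Qed.

End LineTest.

(** * Choice of the parameters *)

Section ParametrizedTest.
Variables (R : archiRealFieldType) (F : finFieldType) (m : nat).
Local Notation V := 'rV[F]_m.
Local Notation q := (#|F|%:R : R).

Theorem parametrized_line_test d (f : V -> F) (P : V -> V -> {poly F}) (eps : R) :
  (0 < d)%N -> oracle d P ->
  (forall x u c t, c != 0 -> (P x (c *: u)).[t] = (P x u).[c * t]) ->
  0 < eps -> eps <= 1 -> d%:R / q <= (eps / 100) ^+ 48 ->
  5 * eps <= \avg_(x : V) \avg_(u : V) ((f x == (P x u).[0])%:R : R) ->
  exists2 Q : V -> F, polyfun d Q & eps ^+ 2 <= \avg_(x : V) ((f x == Q x)%:R : R).
Proof.
move=> d0 oP scP ep0 ep1 hd hag; have q0 := card_gt0 R F.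
pose z := eps / 100; have z0 : 0 < z by rewrite divr_gt0.
have z1 : z <= 1 / 100 by rewrite ler_pM2r // invr_gt0.
have zle1 : z <= 1 by clear -z1; lra.
have zp k : 0 < z ^+ k by rewrite exprn_gt0.
have epz : eps = 100 * z by rewrite /z; field.
have hdz : d%:R <= z ^+ 48 * q by rewrite -ler_pdivrMr.
have qz : q^-1 <= z ^+ 48.
  by apply: le_trans hd; rewrite ler_peMl ?ler1n // invr_ge0 ltW.
clearbody z.
(* As z <= 1/100, spare powers of z pay for the numerical constants. *)
have zz k l : (k + l <= 48)%N -> z ^+ 48 <= z ^+ k * (1 / 100) ^+ l.
  move=> kl; apply: (@le_trans _ _ (z ^+ (k + l))).
    by apply: ler_wiXn2l => //; exact: ltW.
  rewrite exprD ler_pM2l //.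
  by apply: lerXn2r; rewrite ?nnegrE ?divr_ge0 // ltW.
(* With this choice e / eps^2 = 10^-12 eps^4, small against the squared density al^2 >= 441 eps^4;
   the list bound then needs d/q below z^30 / 72. *)
pose e := z ^+ 6.
have e1 : e <= 1 by rewrite exprn_ile1 // ltW.
have hd5 : 72 * d%:R <= e ^+ 5 * q.
  rewrite -exprM; apply: (@le_trans _ _ (72 * z ^+ 48 * q)).
    by rewrite -mulrA ler_pM2l.
  rewrite ler_pM2r //; have := zz 30%N 1%N isT; have := zp 30%N.
  set a := z ^+ 48; set b := z ^+ _; clear -a; lra.
have hq2 : q^-1 <= eps ^+ 2.
  apply: (le_trans qz); have := zz 2%N 0%N isT; have := zp 2%N.
  rewrite epz expr0 mulr1 exprMn; set a := z ^+ 48; set b := z ^+ _; clear -a; lra.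
have [D [H [oH hD hbH]]] := cone_at_good_point d0 oP scP (zp 6%N) e1 hd5 ep0 hq2 hag.
have ep2 : 0 < eps ^+ 2 by rewrite exprn_gt0.
set al := \avg_(x : V) ((D x)%:R : R) in hD.
have al0 : 0 < al by clear -ep2 hD; lra.
have alz : z ^+ 2 <= al.
  apply: le_trans hD; have := zp 2%N; rewrite epz exprMn.
  set b := z ^+ _; clear -b; lra.
have [||Q pQ hQ] := @partial_test R F m d D f H d0 oH al0.
- apply: (@le_trans _ _ (10 ^+ 7 * z ^+ 48 * q)).
    by rewrite -mulrA ler_pM2l // exprn_gt0.
  rewrite ler_pM2r //; apply: (@le_trans _ _ (z ^+ 6)).
    have := zz 6%N 4%N isT; have := zp 6%N.
    set a := z ^+ 48; set b := z ^+ _; clear -a; lra.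
  by rewrite (exprM z 2 3) lerXn2r // nnegrE ltW.
- move: hbH; set bH := avg _ => hbH; rewrite -/al.
  have h1 : 441 * eps ^+ 4 <= al ^+ 2.
    have -> : 441 * eps ^+ 4 = (21 * eps ^+ 2) ^+ 2 by ring.
    apply: lerXn2r => //; rewrite nnegrE; last exact: ltW al0.
    by rewrite mulr_ge0 // ltW.
  apply: le_trans h1.
  have e2 : e / eps ^+ 2 = (1 / 10) ^+ 12 * eps ^+ 4.
    by rewrite /e epz; field; rewrite gt_eqF.
  have h2 := zz 4%N 7%N isT.
  have h3 : eps ^+ 4 = 100 ^+ 4 * z ^+ 4 by rewrite epz exprMn.
  have h4 := zp 4%N.
  rewrite -mulrA e2 in hbH.
  move: hbH qz h2 h3 h4; set a := z ^+ 48; set b := z ^+ 4; set c := eps ^+ 4.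
  set r := q^-1; clear -r; lra.
exists Q => //; apply: (@le_trans _ _ (al / 20)); first by clear -hD ep2; lra.
apply: (le_trans hQ); apply: ler_avg => x; rewrite ler_nat.
by case: (D x).
Qed.

End ParametrizedTest.

(** * From lines as sets to lines with a parametrisation *)

Section LinesOracle.
Variables (F : finFieldType) (m : nat).
Local Notation V := 'rV[F]_m.

Lemma line_scale (x u : V) c : c != 0 -> line x (c *: u) = line x u.
Proof.
move=> c0; apply/setP => y; apply/imsetP/imsetP => -[t _ ->].
  by exists (t * c) => //; rewrite scalerA.
by exists (t / c) => //; rewrite scalerA divfK.
Qed.

Lemma mem_line (x u : V) t : x + t *: u \in line x u.
Proof. by apply/imsetP; exists t. Qed.

Lemma line_self (x u : V) : x \in line x u.
Proof. by have := mem_line x u 0; rewrite scale0r addr0. Qed.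

Lemma lines_throughP (x : V) L :
  reflect (exists2 u, u != 0 & L = line x u) (L \in lines_through x).
Proof.
rewrite !inE; apply: (iffP andP) => [[/existsP[a /existsP[u /andP[u0 /eqP ->]]]]|].
  by case/imsetP => t _ ->; exists u; rewrite ?line_shift.
move=> [u u0 ->]; split; last exact: line_self.
by apply/existsP; exists x; apply/existsP; exists u; rewrite u0 eqxx.
Qed.

Lemma line_eq_dir (x u v : V) : v != 0 -> line x v = line x u ->
  exists2 c, c != 0 & v = c *: u.
Proof.
move=> v0 e; have := mem_line x v 1; rewrite e scale1r => /imsetP[c _ /addrI ec].
by exists c => //; apply: contraNneq v0 => c0; rewrite ec c0 scale0r.
Qed.

(** The degenerate direction 0 receives the constant f(x), so that it always counts as agreement. *)
Lemma param_oracle d (P : {set V} -> V -> F) (f : V -> F) : is_lines_oracle d P ->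
  exists P' : V -> V -> {poly F}, [/\ oracle d P',
    forall x u c t, c != 0 -> (P' x (c *: u)).[t] = (P' x u).[c * t],
    forall x u, u != 0 -> (P' x u).[0] = P (line x u) x &
    forall x, (P' x 0).[0] = f x].
Proof.
move=> oP.
have /choice[p hp] : forall xu : V * V, exists p : {poly F}, (size p <= d.+1)%N /\
    if xu.2 == 0 then p = (f xu.1)%:P
    else forall t, P (line xu.1 xu.2) (xu.1 + t *: xu.2) = p.[t].
  move=> [x u] /=; have [_|u0] := eqVneq u 0.
    by exists (f x)%:P; rewrite size_polyC (leq_trans (leq_b1 _)).
  have [|a [v [p [v0 eL sp hp]]]] := oP (line x u).
    by apply/existsP; exists x; apply/existsP; exists u; rewrite u0 eqxx.
  have := line_self x u; rewrite eL => /imsetP[s _ ex].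
  have [c c0 eu] : exists2 c, c != 0 & u = c *: v.
    by apply: (line_eq_dir (x := x)); rewrite // eL ex line_shift.
  exists (p \Po (s%:P + c *: 'X)); split.
    apply: leq_trans (size_comp_poly_leq _ _) _; rewrite ltnS.
    have s2 : (size (s%:P + c *: 'X)%R <= 2)%N.
      apply: leq_trans (size_polyD _ _) _; rewrite geq_max size_polyC.
      rewrite (leq_trans (leq_b1 _)) //=.
      by apply: leq_trans (size_scale_leq _ _) _; rewrite size_polyX.
    by move: sp s2; case: (size p) => [|k] //=; case: (size _) => [|[|[|l]]] //= *; lia.
  move=> t /=; rewrite -eL horner_comp !hornerE -hp; congr (P _ _).
  by rewrite ex eu scalerA -addrA -scalerDl [t * c]mulrC.
exists (fun x u => p (x, u)).
have p0 x : p (x, 0) = (f x)%:P by have [_] := hp (x, 0); rewrite eqxx.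
have pu x u t : u != 0 -> (p (x, u)).[t] = P (line x u) (x + t *: u).
  by move=> u0; have [_] := hp (x, u); rewrite /= (negbTE u0) => ->.
split.
- split=> [x u|x u s t]; first by case: (hp (x, u)).
  have [->|u0] := eqVneq u 0; first by rewrite scaler0 addr0 p0 !hornerC.
  by rewrite !pu // line_shift scalerDl addrA.
- move=> x u c t c0; have [->|u0] := eqVneq u 0; first by rewrite scaler0 p0 !hornerC.
  by rewrite !pu ?scaler_eq0 ?negb_or ?c0 // line_scale // scalerA mulrC.
- by move=> x u u0; rewrite pu // scale0r addr0.
- by move=> x; rewrite p0 hornerC.
Qed.

Variable R : archiRealFieldType.

Lemma sum_directions (x : V) (G : {set V} -> R) :
  \sum_(u : V | u != 0) G (line x u) =
  (#|F|.-1)%:R * \sum_(L in lines_through x) G L.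
Proof.
rewrite (partition_big (line x) (fun L => L \in lines_through x)) /=; last first.
  by move=> u u0; apply/lines_throughP; exists u.
rewrite mulr_sumr; apply: eq_bigr => L /lines_throughP[u u0 ->].
rewrite (eq_bigr (fun=> G (line x u))); last by move=> v /andP[_ /eqP ->].
rewrite sumr_const mulr_natl; congr (_ *+ _).
rewrite -(cardC1 (0 : F)) -(card_image (f := fun c : F => c *: u)); last first.
  move=> c c' /eqP; rewrite -subr_eq0 -scalerBl scaler_eq0 (negbTE u0) orbF.
  by rewrite subr_eq0 => /eqP.
apply: eq_card => v; rewrite [LHS]unfold_in; apply/andP/imageP => [[v0 /eqP e]|[c c0 ->]].
  by have [c c0 ->] := line_eq_dir v0 e; exists c; rewrite ?inE.
by rewrite inE in c0; rewrite scaler_eq0 negb_or c0 u0 line_scale.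
Qed.

(** Each line through x has q - 1 directions, and the extra direction 0, which always agrees, can
    only raise the average. *)
Lemma agreement_param (f : V -> F) (P : {set V} -> V -> F) (P' : V -> V -> {poly F}) :
  (forall x u, u != 0 -> (P' x u).[0] = P (line x u) x) ->
  (forall x, (P' x 0).[0] = f x) ->
  agreement R f P <= \avg_(x : V) \avg_(u : V) ((f x == (P' x u).[0])%:R : R).
Proof.
move=> hP h0; rewrite /agreement cardsT mulrC.
apply: (@ler_avg R V (fun x => #|lines_through x|%:R^-1 *
  \sum_(L in lines_through x) (f x == P L x)%:R)) => x.
set l := #|lines_through x|; set S := \sum_(L in _) _.
have N0 : (0 : R) < #|{: V}|%:R by rewrite ltr0n; apply/card_gt0P; exists 0.
have eN : (#|{: V}|%:R : R) = (#|F|.-1)%:R * l%:R + 1.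
  have := sum_directions x (fun=> 1); rewrite !sumr_const -/l => <-.
  rewrite -[1]/(1%:R) -natrD addn1 (_ : #|_| = #|{: V}|.-1) ?prednK //; last first.
    by have := cardC1 (0 : V).
  by apply/card_gt0P; exists 0.
have hS : \sum_(u : V | u != 0) ((f x == (P' x u).[0])%:R : R) = (#|F|.-1)%:R * S.
  rewrite -(sum_directions x (fun L => (f x == P L x)%:R)).
  by apply: eq_bigr => u u0; rewrite hP.
have Sl : S <= l%:R.
  by rewrite -sumr_const; apply: ler_sum => L _; rewrite lern1 leq_b1.
have S0 : 0 <= S by apply: sumr_ge0.
rewrite /avg (bigD1 0) //= h0 eqxx hS ler_pdivlMr // eN.
(* With no line through x, the average over lines is 0 because the inverse of 0 is 0. *)
have [l0|l0] := eqVneq l 0%N.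
  by rewrite l0 invr0 mul0r mul0r addr_ge0 // mulr_ge0.
have l1 : (0 : R) < l%:R by rewrite ltr0n lt0n.
rewrite (_ : _ * (_ + 1) = S / l%:R + (#|F|.-1)%:R * S); last first.
  by field; rewrite gt_eqF.
by rewrite lerD2r ler_pdivrMr // mul1r.
Qed.

End LinesOracle.

From mathcomp Require Import all_classical all_reals all_analysis.

Theorem theorem5p6 (R : realType) :
  exists C : R, 0 < C /\
  forall (F : finFieldType) (d m : nat) (eps0 : R),
    (2 <= m)%N ->
    0 < eps0 -> eps0 < 1 ->
    C * (d%:R / #|F|%:R) `^ (48%:R^-1) <= eps0 ->
    forall (eps : R), eps0 <= eps ->
    forall (f : 'rV[F]_m -> F) (P : {set 'rV[F]_m} -> 'rV[F]_m -> F),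
      is_lines_oracle d P ->
      5%:R * eps <= agreement R f P ->
      exists Q : mpoly.mpoly m F, tdeg_le d Q /\ eps ^+ 2 <= pt_agreement R f Q.
Proof.
(* The hypothesis then reads d/q <= (eps/100)^48 after taking 48th powers. *)
exists 100; split=> // F d m eps0 _ e00 _ hd eps heps f P oP hag.
have ep0 : 0 < eps by apply: lt_le_trans heps.
have [P' [oP' scP' hP' hP0]] := param_oracle f oP.
have {}hag := le_trans hag (agreement_param R hP' hP0).
suff [h [Q sQ hQ] hh] : exists2 h : 'rV[F]_m -> F, polyfun d h &
    eps ^+ 2 <= \avg_(x : 'rV[F]_m) ((f x == h x)%:R : R).
  exists Q; split=> //; apply: (le_trans hh).
  rewrite avg_card /pt_agreement cardsT le_eqVlt; apply/orP; left; apply/eqP.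
  by congr (_%:R / _); apply: eq_card => x; rewrite !inE -hQ.
have [d0|d0] := posnP d.
  by rewrite d0 in oP' *; exact: (constant_test oP' ep0 hag).
apply: (parametrized_line_test d0 oP' scP' ep0 _ _ hag).
  (* Only eps0 is assumed below 1; eps is bounded because an agreement probability is at most 1. *)
  suff : 5 * eps <= 1 by clear -ep0; lra.
  apply: (le_trans hag); apply: (avg_le 0) => x; apply: (avg_le 0) => u.
  by rewrite lern1 leq_b1.
set x := d%:R / #|F|%:R in hd *.
have x0 : 0 <= x by rewrite divr_ge0.
have -> : x = (x `^ 48%:R^-1) ^+ 48.
  by rewrite -powR_mulrn ?powR_ge0 // -powRrM mulVf ?powRr1 // pnatr_eq0.
apply: lerXn2r; rewrite ?nnegrE ?powR_ge0 //; first by rewrite divr_ge0 // ltW.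
by rewrite ler_pdivlMr // mulrC (le_trans hd).
Qed.
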